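(* Let $n\ge0$ be an integer. For complex $z$ with $|z|<1$, $$\Bigl[(1-z)\frac{d}{dz}(1-z)\Bigr]^n\frac{\arcsin\sqrt z}{\sqrt{z(1-z)}}=\frac{n!}{4^{n}}\frac{(1-z)^{n-1/2}}{z^{n+1/2}}\Biggl[(-1)^n\binom{2n}{n}\arcsin\sqrt z+\sum_{\substack{0\le k\le2n\\k\ne n}}(-1)^k\binom{2n}{k}\frac{\sin[2(n-k)\arcsin\sqrt z]}{2(n-k)}\Biggr].$$
   Context: The operator $(1-z)\frac{d}{dz}(1-z)$ sends a function $f$ to the function $(1-z)\frac{d}{dz}\bigl[(1-z)f(z)\bigr]$, and its $n$-th power is its $n$-fold composition (the identity for $n=0$). Square root, $\arcsin$ and non-integer powers are principal branches, so $z^{n+1/2}=(\sqrt z)^{2n+1}$. At $z=0$ the function $\arcsin\sqrt z/\sqrt{z(1-z)}$ and the right-hand side are understood by continuous extension (removable singularities). Empty sums are $0$. *)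

(* Defs.v *)
(* Stdlib reals with Coquelicot's complex numbers C = R * R. *)
From Stdlib Require Import Reals Factorial.
From Coquelicot Require Import Coquelicot.

Open Scope R_scope.
Open Scope C_scope.

(* Values in (-PI, PI] for z <> 0; the value at z = 0 is irrelevant. *)
Definition Carg (z : C) : R :=
  if Rlt_dec (Im z) 0 then (- acos (Re z / Cmod z))%R
  else acos (Re z / Cmod z)%R.

Definition Cexp (z : C) : C :=
  ((exp (Re z) * cos (Im z))%R, (exp (Re z) * sin (Im z))%R).

(* Principal logarithm, meaningful for z <> 0. *)
Definition Clog (z : C) : C := (ln (Cmod z), Carg z).

(* Principal value of z ^ a, meaningful for z <> 0. *)
Definition Cpower (z a : C) : C := Cexp (a * Clog z).

Definition Csqrt (z : C) : C :=
  if Ceq_dec z 0 then 0 else Cpower z (1 / 2).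

Definition Csin (z : C) : C := (Cexp (Ci * z) - Cexp (- (Ci * z))) / (2 * Ci).

Definition Carcsin (z : C) : C := - Ci * Clog (Ci * z + Csqrt (1 - z ^ 2)).

(* C_lim only tests approach along the horizontal line through the point; it is
   the limit of g at a as soon as that limit exists, i.e. under this predicate. *)
Definition has_Clim (g : C -> C) (a : C) : Prop :=
  exists l : C, filterlim g (locally' a) (locally l).

(* g with its value at 0 replaced by its limit there. *)
Definition Cext0 (g : C -> C) (z : C) : C :=
  if Ceq_dec z 0 then C_lim g 0 else g z.

(* The operator (1 - z) d/dz (1 - z). Like C_lim, C_derive is the complex
   derivative only where the function is complex differentiable. *)
Definition opD (f : C -> C) (z : C) : C :=
  (1 - z) * C_derive (fun w : C => (1 - w) * f w) z.

(* opD ^ n f really is an iterated complex derivative on the open unit disc. *)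
Definition opD_defined (n : nat) (f : C -> C) : Prop :=
  forall (m : nat) (z : C), (m < n)%nat -> (Cmod z < 1)%R ->
    ex_derive (fun w : C => (1 - w) * Nat.iter m opD f w) z.

Definition arcsin_fun (z : C) : C :=
  Carcsin (Csqrt z) / Csqrt (z * (1 - z)).

(* sum_n a N sums a 0, ..., a N; RtoC embeds the real coefficients and
   Binomial.C is the real-valued binomial coefficient. *)
Definition arcsin_rhs (n : nat) (z : C) : C :=
  RtoC (INR (fact n) / 4 ^ n)%R
  * (Cpower (1 - z) (RtoC (INR n - 1 / 2)%R) / Csqrt z ^ (2 * n + 1))
  * (RtoC ((-1) ^ n * Binomial.C (2 * n) n)%R * Carcsin (Csqrt z)
     + sum_n (G := C_AbelianMonoid) (fun k : nat =>
         if Nat.eqb k n then RtoC 0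
         else RtoC ((-1) ^ k * Binomial.C (2 * n) k)%R
              * (Csin (RtoC (2 * (INR n - INR k))%R * Carcsin (Csqrt z))
                 / RtoC (2 * (INR n - INR k))%R))
         (2 * n)).

(* Main.v *)
Require Import Defs.
From Stdlib Require Import Reals Factorial Lra Lia.
From Coquelicot Require Import Coquelicot.

(* Put s = sqrt z and t = arcsin s. By the binomial theorem the derivative in t of
   the bracket is (e^{it} - e^{-it})^{2n} = (-4)^n sin^{2n} t, so the bracket is
   (-4)^n times the integral of sin^{2n} from 0 to t. With the reduction formula
   relating these integrals for n and n + 1, one application of the operator takes
   the right-hand side for n to the one for n + 1. The right-hand side is an even
   function of s, hence differentiable in z also across the branch cut of sqrt; at
   z = 0 differentiability follows from the existence of the limits of the function
   and of its derivative. *)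

Local Open Scope R_scope.
Local Open Scope C_scope.

(** No complex integral is ever formed: the integral of sin^{2n} is represented by the bracket
    itself, characterised on the unit disc by its derivative in s and its zero at 0, and identities
    between brackets are checked by comparing derivatives and values at 0. In the variable s
    everything except the bracket is algebraic in s and c = sqrt (1 - s^2), and (1 - z) d/dz becomes
    (1 - s^2)/(2s) d/ds. The prefactor n!/4^n is what one step dictates: the reduction formula
    contributes (2n + 2)/4 and dz = 2s ds another 1/2, so consecutive constants have ratio (2n +
    2)/8 = (n + 1)/4. The point z = 0 needs no power series: off 0 the derivative is, up to the
    factor 1/(1 - z), the right-hand side for n + 1, so its limit at 0 is again the limit of a
    right-hand side, and the mean value inequality carries it over to the point itself. *)

(** * Complex derivatives and the mean value inequality *)

Definition is_Cderive (f : C -> C) (z l : C) : Prop :=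
  is_derive (K := C_AbsRing) (V := C_NormedModule) f z l.
(** [C] carries two normed-module structures over itself, one built on the product [R * R] and one
    induced by the ring. The rules for the identity and for products are stated in the second, so
    derivatives are moved between the two. *)
Lemma is_Cderive_AbsRing (f : C -> C) (z l : C) :
  is_Cderive f z l <->
  is_derive (K := C_AbsRing) (V := AbsRing_NormedModule C_AbsRing) f z l.
Proof.
  split; intros [[H1 H2 H3] H4]; (split; [ split; [exact H1 | exact H2 | exact H3] | exact H4]).
Qed.

Lemma locally_Cmod (z : C) (P : C -> Prop) :
  locally (T := C_UniformSpace) z P <->
  exists d : R, (0 < d)%R /\ forall w : C, (Cmod (w - z) < d)%R -> P w.
Proof.
  rewrite locally_C; split.
  - intros [d Hd]; exists d; split; [apply cond_pos | exact Hd].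
  - intros [d [Hd H]]; exists (mkposreal d Hd); exact H.
Qed.

Lemma locally_Cmod_A (z : C) (P : C -> Prop) :
  locally (T := AbsRing_UniformSpace C_AbsRing) z P <->
  exists d : R, (0 < d)%R /\ forall w : C, (Cmod (w - z) < d)%R -> P w.
Proof. rewrite <- locally_C; apply locally_Cmod. Qed.

Lemma is_Cderive_eps (f : C -> C) (z l : C) :
  is_Cderive f z l <->
  forall eps : R, (0 < eps)%R -> exists d : R, (0 < d)%R /\
    forall w : C, (Cmod (w - z) < d)%R ->
      (Cmod (f w - f z - (w - z) * l) <= eps * Cmod (w - z))%R.
Proof.
  split.
  - intros [_ H] eps Heps.
    specialize (H z (fun P HP => HP) (mkposreal eps Heps)).
    apply locally_Cmod_A in H; exact H.
  - intros H; apply is_Cderive_AbsRing; split; [apply is_linear_scal_l|].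
    intros x Hx eps.
    apply (is_filter_lim_locally_unique (V := AbsRing_NormedModule C_AbsRing)) in Hx.
    rewrite <- Hx; clear x Hx.
    apply locally_Cmod_A.
    exact (H eps (cond_pos eps)).
Qed.

Lemma is_Cderive_const (a z : C) : is_Cderive (fun _ => a) z 0.
Proof. apply is_Cderive_AbsRing, (is_derive_const (V := AbsRing_NormedModule C_AbsRing)). Qed.

Lemma is_Cderive_id (z : C) : is_Cderive (fun w => w) z 1.
Proof. apply is_Cderive_AbsRing, (is_derive_id (K := C_AbsRing)). Qed.

Lemma is_Cderive_plus (f g : C -> C) (z a b : C) :
  is_Cderive f z a -> is_Cderive g z b -> is_Cderive (fun w => f w + g w) z (a + b).
Proof. apply (is_derive_plus (V := C_NormedModule)). Qed.

Lemma is_Cderive_minus (f g : C -> C) (z a b : C) :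
  is_Cderive f z a -> is_Cderive g z b -> is_Cderive (fun w => f w - g w) z (a - b).
Proof. apply (is_derive_minus (V := C_NormedModule)). Qed.

Lemma is_Cderive_mult (f g : C -> C) (z a b : C) :
  is_Cderive f z a -> is_Cderive g z b ->
  is_Cderive (fun w => f w * g w) z (a * g z + f z * b).
Proof.
  rewrite !is_Cderive_AbsRing; intros Hf Hg.
  apply (is_derive_mult (K := C_AbsRing) f g z a b Hf Hg), Cmult_comm.
Qed.

Lemma is_Cderive_comp (f g : C -> C) (z a b : C) :
  is_Cderive f (g z) a -> is_Cderive g z b -> is_Cderive (fun w => f (g w)) z (b * a).
Proof.
  intros Hf Hg; rewrite is_Cderive_AbsRing in Hg.
  exact (is_derive_comp f g z a b Hf Hg).
Qed.

Lemma is_Cderive_value (f : C -> C) (z a b : C) :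
  is_Cderive f z a -> a = b -> is_Cderive f z b.
Proof. now intros H <-. Qed.

Lemma is_Cderive_ext_loc (f g : C -> C) (z l : C) (d : R) :
  (0 < d)%R -> (forall w, (Cmod (w - z) < d)%R -> f w = g w) ->
  is_Cderive f z l -> is_Cderive g z l.
Proof.
  intros Hd H; apply is_derive_ext_loc.
  apply locally_Cmod_A; exists d; split; assumption.
Qed.

Lemma is_Cderive_continuous (f : C -> C) (z l : C) :
  is_Cderive f z l ->
  forall eps : R, (0 < eps)%R -> exists d : R, (0 < d)%R /\
    forall w : C, (Cmod (w - z) < d)%R -> (Cmod (f w - f z) < eps)%R.
Proof.
  intros H eps Heps.
  destruct (proj1 (is_Cderive_eps f z l) H 1%R Rlt_0_1) as [d [Hd Hf]].
  assert (HM : (0 < 1 + Cmod l)%R) by (pose proof (Cmod_ge_0 l); lra).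
  exists (Rmin d (eps / (1 + Cmod l)))%R; split.
  { apply Rmin_glb_lt; [exact Hd | now apply Rdiv_lt_0_compat]. }
  intros w Hw.
  assert (H1 := Hf w (Rlt_le_trans _ _ _ Hw (Rmin_l _ _))).
  assert (H2 := Rlt_le_trans _ _ _ Hw (Rmin_r _ _)).
  replace (f w - f z) with ((f w - f z - (w - z) * l) + (w - z) * l) by ring.
  eapply Rle_lt_trans; [apply Cmod_triangle|].
  rewrite Cmod_mult.
  apply Rlt_div_r in H2; [nra | exact HM].
Qed.

Lemma is_Cderive_inv (z : C) : z <> 0 -> is_Cderive Cinv z (- / (z * z)).
Proof.
  intros Hz; apply is_Cderive_eps; intros eps Heps.
  assert (Hm : (0 < Cmod z)%R) by now apply Cmod_gt_0.
  (* The error equals |w - z|^2 / (|z|^2 |w|). The first bound keeps |w| above |z|/2, and the second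
     then makes the factor 2 |w - z| / |z|^3 at most [eps]. *)
  set (d := Rmin (Cmod z / 2) (eps * (Cmod z) ^ 3 / 2)).
  assert (Hm3 : (0 < Cmod z ^ 3)%R) by now apply pow_lt.
  exists d; split; [apply Rmin_glb_lt; nra|].
  intros w Hw.
  assert (H1 := Rlt_le_trans _ _ _ Hw (Rmin_l _ _)).
  assert (H2 := Rlt_le_trans _ _ _ Hw (Rmin_r _ _)).
  assert (H3 : (Cmod z / 2 < Cmod w)%R).
  { pose proof (Cmod_triangle w (z - w)).
    replace (w + (z - w)) with z in H by ring.
    replace (z - w) with (- (w - z)) in H by ring.
    rewrite Cmod_opp in H; lra. }
  assert (Hw0 : w <> 0) by (apply Cmod_gt_0; lra).
  replace (/ w - / z - (w - z) * - / (z * z)) with ((w - z) * ((w - z) / (z * z * w)))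
    by (field; split; assumption).
  rewrite Cmod_mult, Rmult_comm.
  apply Rmult_le_compat_r; [apply Cmod_ge_0|].
  rewrite Cmod_div, !Cmod_mult by (repeat apply Cmult_neq_0; assumption).
  apply Rle_div_l; [apply Rlt_gt; repeat apply Rmult_lt_0_compat; lra|].
  apply Rlt_le, (Rlt_le_trans _ _ _ H2).
  replace (eps * Cmod z ^ 3 / 2)%R with (eps * (Cmod z * Cmod z * (Cmod z / 2)))%R by field.
  apply Rmult_le_compat_l; [lra|].
  apply Rmult_le_compat_l; [nra | lra].
Qed.

Lemma is_Cderive_div (f g : C -> C) (z a b : C) :
  is_Cderive f z a -> is_Cderive g z b -> g z <> 0 ->
  is_Cderive (fun w => f w / g w) z ((a * g z - f z * b) / (g z * g z)).
Proof.
  intros Hf Hg Hz.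
  eapply is_Cderive_value.
  - apply (is_Cderive_mult f (fun w => / g w)); [exact Hf|].
    apply (is_Cderive_comp Cinv g); [now apply is_Cderive_inv | exact Hg].
  - field; exact Hz.
Qed.

Lemma is_Cderive_pow (f : C -> C) (z a : C) (n : nat) :
  is_Cderive f z a -> is_Cderive (fun w => f w ^ n) z (RtoC (INR n) * f z ^ (n - 1) * a).
Proof.
  intros Hf; induction n as [|n IH].
  - eapply is_Cderive_value; [apply (is_Cderive_const 1) | simpl; ring].
  - eapply is_Cderive_value; [exact (is_Cderive_mult f _ z _ _ Hf IH)|].
    rewrite S_INR, RtoC_plus; simpl; rewrite Nat.sub_0_r.
    destruct n; simpl; [ring|]. rewrite Nat.sub_0_r; ring.
Qed.

Lemma Re_Cmult_conj_self (h : C) : Re (Cconj h * h) = (Cmod h ^ 2)%R.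
Proof. rewrite Cmod2_alt; destruct h; simpl; ring. Qed.

(* The real mean value theorem is applied to t -> Re (conj h * f (a + t (b - a)))
   with h = f b - f a, whose increment is |h|^2. *)
Lemma Cmod_increment_le (f f' : C -> C) (a b : C) (M : R) :
  (forall t : R, (0 <= t <= 1)%R ->
     is_Cderive f (a + RtoC t * (b - a)) (f' (a + RtoC t * (b - a))) /\
     (Cmod (f' (a + RtoC t * (b - a))%C) <= M)%R) ->
  (Cmod (f b - f a) <= M * Cmod (b - a))%R.
Proof.
  intros H.
  set (h := f b - f a); set (p := fun t : R => a + RtoC t * (b - a)).
  set (g := fun t : R => Re (Cconj h * f (p t))).
  set (g' := fun t : R => Re (Cconj h * f' (p t) * (b - a))).
  assert (Hg : forall t, (0 <= t <= 1)%R -> derivable_pt_lim g t (g' t)).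
  { intros t Ht eps Heps.
    (* The summand 1 keeps [k] positive when [h] or [b - a] vanishes, and makes the final estimate
       strict. *)
    set (k := (1 + Cmod h * Cmod (b - a))%R).
    pose proof (Cmod_ge_0 h); pose proof (Cmod_ge_0 (b - a)).
    assert (Hk : (0 < k)%R) by (unfold k; nra).
    destruct (proj1 (is_Cderive_eps _ _ _) (proj1 (H t Ht)) (eps / k)%R) as [d [Hd Hf]].
    { now apply Rdiv_lt_0_compat. }
    assert (Hk' : (0 < 1 + Cmod (b - a))%R) by lra.
    exists (mkposreal (d / (1 + Cmod (b - a))) (Rdiv_lt_0_compat _ _ Hd Hk')).
    intros x Hx Hxd; simpl in Hxd.
    assert (Hp : p (t + x)%R - p t = RtoC x * (b - a)) by (unfold p; rewrite RtoC_plus; ring).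
    specialize (Hf (p (t + x)%R)).
    change (a + RtoC t * (b - a)) with (p t) in Hf.
    rewrite Hp, Cmod_mult, Cmod_R in Hf.
    assert (Hx0 : (0 < Rabs x)%R) by now apply Rabs_pos_lt.
    assert (Hlt : (Rabs x * Cmod (b - a) < d)%R).
    { apply Rlt_div_r in Hxd; [nra | exact Hk']. }
    specialize (Hf Hlt).
    replace ((g (t + x)%R - g t) / x - g' t)%R
      with (Re (Cconj h * (f (p (t + x)%R) - f (p t) - RtoC x * (b - a) * f' (p t))) / x)%R.
    2:{ unfold g, g'; destruct (f (p (t + x)%R)), (f (p t)), (f' (p t)), (b - a), (Cconj h).
        simpl; field; exact Hx. }
    unfold Rdiv at 1; rewrite Rabs_mult, Rabs_inv.
    apply Rlt_div_l; [exact Hx0|].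
    eapply Rle_lt_trans; [apply re_le_Cmod|].
    rewrite Cmod_mult, Cmod_conj.
    apply Rle_lt_trans with (Cmod h * (eps / k * (Rabs x * Cmod (b - a))))%R.
    { now apply Rmult_le_compat_l. }
    replace (Cmod h * (eps / k * (Rabs x * Cmod (b - a))))%R
      with (eps * Rabs x * (Cmod h * Cmod (b - a) / k))%R by (field; lra).
    rewrite <- (Rmult_1_r (eps * Rabs x)) at 2.
    apply Rmult_lt_compat_l; [nra|].
    apply Rlt_div_l; [exact Hk | unfold k; lra]. }
  destruct (MVT_cor2 g g' 0 1 Rlt_0_1 Hg) as [x [Hx Hx01]].
  assert (Hinc : (g 1 - g 0 = Cmod h ^ 2)%R).
  { rewrite <- Re_Cmult_conj_self.
    unfold g, p; replace (a + 1 * (b - a)) with b by ring.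
    replace (a + 0 * (b - a)) with a by ring.
    unfold h at 4; destruct (f a), (f b), (Cconj h); simpl; ring. }
  rewrite Hinc in Hx.
  assert (Hle : (Cmod h ^ 2 <= Cmod h * (M * Cmod (b - a)))%R).
  { rewrite Hx, Rminus_0_r, Rmult_1_r.
    eapply Rle_trans; [apply Rle_abs|].
    eapply Rle_trans; [apply re_le_Cmod|].
    rewrite !Cmod_mult, Cmod_conj, Rmult_assoc.
    apply Rmult_le_compat_l; [apply Cmod_ge_0|].
    apply Rmult_le_compat_r; [apply Cmod_ge_0|].
    apply H; lra. }
  destruct (Req_dec (Cmod h) 0) as [H0|H0].
  - rewrite H0; apply Rmult_le_pos; [|apply Cmod_ge_0].
    eapply Rle_trans; [apply Cmod_ge_0 | apply (H 0%R); lra].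
  - pose proof (Cmod_ge_0 h); simpl in Hle; nra.
Qed.

Lemma Cmod_scal_lt (t : R) (z : C) (r : R) :
  (0 <= t <= 1)%R -> (Cmod z < r)%R -> (Cmod (RtoC t * z) < r)%R.
Proof.
  intros Ht Hz; rewrite Cmod_mult, Cmod_R, Rabs_right by lra.
  pose proof (Cmod_ge_0 z); nra.
Qed.

(** The mean value inequality with bound 0, applied to f - g on the segment from 0 to z. This
    replaces integration in the oddness and the reduction formula of the bracket. *)
Lemma eq_of_is_Cderive_eq (f g h : C -> C) :
  (forall z, (Cmod z < 1)%R -> is_Cderive f z (h z)) ->
  (forall z, (Cmod z < 1)%R -> is_Cderive g z (h z)) ->
  f 0 = g 0 -> forall z, (Cmod z < 1)%R -> f z = g z.
Proof.
  intros Hf Hg H0 z Hz.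
  assert (H : (Cmod ((f z - g z) - (f 0 - g 0)) <= 0 * Cmod (z - 0))%R).
  { apply (Cmod_increment_le (fun w => f w - g w) (fun _ => 0)).
    intros t Ht.
    replace (0 + RtoC t * (z - 0)) with (RtoC t * z) by ring.
    split; [|rewrite Cmod_0; lra].
    eapply is_Cderive_value.
    - apply is_Cderive_minus; [apply Hf | apply Hg]; now apply Cmod_scal_lt.
    - ring. }
  assert (Hm : Cmod ((f z - g z) - (f 0 - g 0)) = 0%R).
  { apply Rle_antisym; [lra | apply Cmod_ge_0]. }
  apply Cmod_eq_0 in Hm; rewrite H0 in Hm.
  replace (f z) with (f z - g z - (g 0 - g 0) + g z) by ring.
  rewrite Hm; ring.
Qed.

(** * The complex exponential *)

Lemma Cexp_plus (a b : C) : Cexp (a + b) = Cexp a * Cexp b.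
Proof.
  unfold Cexp; destruct a as [x y], b as [u v]; simpl.
  rewrite exp_plus, cos_plus, sin_plus.
  apply injective_projections; simpl; ring.
Qed.

Lemma Cexp_0 : Cexp 0 = 1.
Proof. unfold Cexp; simpl; rewrite exp_0, cos_0, sin_0, !Rmult_1_l; reflexivity. Qed.

Lemma Cexp_neq_0 (z : C) : Cexp z <> 0.
Proof.
  intros H; apply C1_nz.
  rewrite <- Cexp_0; replace (RtoC 0) with (z + - z) by ring.
  rewrite Cexp_plus, H; ring.
Qed.

Lemma Cexp_opp (z : C) : Cexp (- z) = / Cexp z.
Proof.
  pose proof (Cexp_neq_0 z) as Hz.
  assert (H : Cexp z * Cexp (- z) = 1).
  { rewrite <- Cexp_plus; replace (z + - z) with (RtoC 0) by ring; apply Cexp_0. }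
  rewrite <- (Cmult_1_r (/ Cexp z)), <- H; field; exact Hz.
Qed.

Lemma Cexp_INR_mult (n : nat) (z : C) : Cexp (RtoC (INR n) * z) = Cexp z ^ n.
Proof.
  induction n as [|n IH].
  - simpl; rewrite <- Cexp_0; f_equal; ring.
  - rewrite S_INR, RtoC_plus, Cpow_S, <- IH, <- Cexp_plus; f_equal; ring.
Qed.

Lemma derivable_pt_lim_at_0 (f : R -> R) (l : R) :
  derivable_pt_lim f 0 l -> forall eps : R, (0 < eps)%R ->
  exists d : R, (0 < d)%R /\
    forall x : R, (Rabs x < d)%R -> (Rabs (f x - f 0 - l * x) <= eps * Rabs x)%R.
Proof.
  intros H eps Heps; destruct (H eps Heps) as [d Hd].
  exists d; split; [apply cond_pos|]; intros x Hx.
  destruct (Req_dec x 0) as [->|Hx0].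
  { rewrite Rabs_R0, Rmult_0_r, Rmult_0_r, Rminus_0_r.
    unfold Rminus; rewrite Rplus_opp_r, Rabs_R0; apply Rle_refl. }
  specialize (Hd x Hx0 Hx); rewrite Rplus_0_l in Hd.
  replace (f x - f 0 - l * x)%R with (((f x - f 0) / x - l) * x)%R by (field; exact Hx0).
  rewrite Rabs_mult; apply Rmult_le_compat_r; [apply Rabs_pos | lra].
Qed.

Lemma Cmod_le_Rabs_Re_Im (z : C) : (Cmod z <= Rabs (Re z) + Rabs (Im z))%R.
Proof.
  destruct z as [x y]; simpl.
  replace (x, y) with (RtoC x + Ci * RtoC y) by (apply injective_projections; simpl; ring).
  eapply Rle_trans; [apply Cmod_triangle|].
  rewrite Cmod_mult, Cmod_Ci, !Cmod_R; lra.
Qed.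

Lemma im_le_Cmod (z : C) : (Rabs (Im z) <= Cmod z)%R.
Proof. eapply Rle_trans; [apply Rmax_r | apply Rmax_Cmod]. Qed.

Lemma is_Cderive_Cexp_0 : is_Cderive Cexp 0 1.
Proof.
  apply is_Cderive_eps; intros eps Heps.
  (* The remainder is at most 3 e r in its real part and 5 e r in its imaginary part, with r = |w|;
     hence the 8. *)
  set (e := Rmin 1 (eps / 8)).
  assert (He : (0 < e)%R) by (apply Rmin_glb_lt; lra).
  assert (He1 : (e <= 1)%R) by apply Rmin_l.
  assert (He2 : (e <= eps / 8)%R) by apply Rmin_r.
  clearbody e.
  destruct (derivable_pt_lim_at_0 _ _ (derivable_pt_lim_exp 0) e He) as [d1 [Hd1 H1]].
  destruct (derivable_pt_lim_at_0 _ _ (derivable_pt_lim_sin 0) e He) as [d2 [Hd2 H2]].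
  destruct (derivable_pt_lim_at_0 _ _ (derivable_pt_lim_cos 0) e He) as [d3 [Hd3 H3]].
  exists (Rmin e (Rmin d1 (Rmin d2 d3))); split.
  { repeat apply Rmin_glb_lt; assumption. }
  intros w Hw.
  replace (w - 0) with w in * by ring.
  pose proof (re_le_Cmod w) as Hre; pose proof (im_le_Cmod w) as Him.
  pose proof (Rmin_l e (Rmin d1 (Rmin d2 d3))).
  pose proof (Rmin_r e (Rmin d1 (Rmin d2 d3))).
  pose proof (Rmin_l d1 (Rmin d2 d3)).
  pose proof (Rmin_r d1 (Rmin d2 d3)).
  pose proof (Rmin_l d2 d3).
  pose proof (Rmin_r d2 d3).
  set (r := Cmod w) in *; destruct w as [x y]; simpl in Hre, Him.
  specialize (H1 x ltac:(lra)); specialize (H2 y ltac:(lra)); specialize (H3 y ltac:(lra)).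
  rewrite exp_0, Rmult_1_l in H1; rewrite sin_0, cos_0, Rmult_1_l, Rminus_0_r in H2.
  rewrite cos_0, sin_0, Ropp_0, Rmult_0_l, Rminus_0_r in H3.
  set (u := (exp x - 1 - x)%R) in *; set (v := (sin y - y)%R) in *;
  set (c := (cos y - 1)%R) in *.
  rewrite Cexp_0.
  (* Regrouped so that every summand contains one of the real first-order remainders [u], [v], [c],
     except x sin y, which is a product of two small factors. *)
  replace (Cexp (x, y) - 1 - (x, y) * 1)
    with ((u * cos y + (1 + x) * c)%R, ((u + x) * sin y + v)%R).
  2:{ unfold u, v, c, Cexp; apply injective_projections; simpl; ring. }
  eapply Rle_trans; [apply Cmod_le_Rabs_Re_Im|]; simpl.
  assert (Hcos : (Rabs (cos y) <= 1)%R) by (apply Rabs_le; apply COS_bound).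
  pose proof (Rabs_pos x); pose proof (Rabs_pos y).
  assert (Hr : (0 <= r)%R) by apply Cmod_ge_0.
  assert (Hr1 : (r <= e)%R) by lra.
  assert (Her : (0 <= e * r)%R) by nra.
  assert (Hu : (Rabs u <= e * r)%R) by nra.
  assert (Hv : (Rabs v <= e * r)%R) by nra.
  assert (Hc : (Rabs c <= e * r)%R) by nra.
  assert (Hs : (Rabs (sin y) <= 2 * r)%R).
  { replace (sin y) with (v + y)%R by (unfold v; ring).
    eapply Rle_trans; [apply Rabs_triang|]; nra. }
  assert (Hux : (Rabs (u + x) <= 2 * e)%R).
  { eapply Rle_trans; [apply Rabs_triang|]; nra. }
  assert (T1 : (Rabs (u * cos y + (1 + x) * c) <= 3 * (e * r))%R).
  { eapply Rle_trans; [apply Rabs_triang|]; rewrite !Rabs_mult.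
    assert (Rabs (1 + x) <= 2)%R.
    { eapply Rle_trans; [apply Rabs_triang|]; rewrite Rabs_R1; lra. }
    pose proof (Rabs_pos u); pose proof (Rabs_pos c); nra. }
  assert (T2 : (Rabs ((u + x) * sin y + v) <= 5 * (e * r))%R).
  { eapply Rle_trans; [apply Rabs_triang|]; rewrite !Rabs_mult.
    pose proof (Rabs_pos (u + x)); pose proof (Rabs_pos (sin y)).
    assert (Rabs (u + x) * Rabs (sin y) <= 2 * e * (2 * r))%R
      by (apply Rmult_le_compat; assumption).
    lra. }
  nra.
Qed.

(** The functional equation exp w = exp z exp (w - z) moves the claim to the point 0. *)
Lemma is_Cderive_Cexp (z : C) : is_Cderive Cexp z (Cexp z).
Proof.
  apply (is_Cderive_ext_loc (fun w => Cexp z * Cexp (w - z)) _ _ _ 1 Rlt_0_1).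
  { intros w _; rewrite <- Cexp_plus; f_equal; ring. }
  eapply is_Cderive_value.
  - apply is_Cderive_mult; [apply is_Cderive_const|].
    apply (is_Cderive_comp Cexp (fun w => w - z)).
    + replace (z - z) with (RtoC 0) by ring; apply is_Cderive_Cexp_0.
    + apply is_Cderive_minus; [apply is_Cderive_id | apply is_Cderive_const].
  - cbv beta; ring.
Qed.

(** * Principal argument and logarithm *)

Lemma Re_div_Cmod_bound (z : C) : z <> 0 -> (-1 <= Re z / Cmod z <= 1)%R.
Proof.
  intros Hz; apply Cmod_gt_0 in Hz.
  pose proof (re_le_Cmod z) as H; apply Rabs_le_between in H.
  split; [apply Rle_div_r | apply Rle_div_l]; lra.
Qed.

Lemma cos_Carg (z : C) : z <> 0 -> cos (Carg z) = (Re z / Cmod z)%R.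
Proof.
  intros Hz; unfold Carg; pose proof (Re_div_Cmod_bound z Hz).
  destruct Rlt_dec; rewrite ?cos_neg; now apply cos_acos.
Qed.

Lemma sin_Carg (z : C) : z <> 0 -> sin (Carg z) = (Im z / Cmod z)%R.
Proof.
  intros Hz; pose proof (Re_div_Cmod_bound z Hz) as Hb.
  apply Cmod_gt_0 in Hz.
  assert (Hs : sin (acos (Re z / Cmod z)) = (Rabs (Im z) / Cmod z)%R).
  { rewrite sin_acos by exact Hb.
    rewrite <- (sqrt_Rsqr (Rabs (Im z) / Cmod z))
      by (apply Rdiv_le_0_compat; [apply Rabs_pos | exact Hz]).
    f_equal; rewrite !Rsqr_div', <- Rsqr_abs.
    pose proof (Cmod2_alt z) as H2.
    unfold Rsqr; field_simplify_eq; lra. }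
  unfold Carg; destruct Rlt_dec as [H|H].
  - rewrite sin_neg, Hs, Rabs_left by exact H; field; lra.
  - rewrite Hs, Rabs_right by lra; reflexivity.
Qed.

(** Only the strictness at -PI needs an argument: that value could arise only in the case Im z < 0,
    where the sine of the argument is Im z / |z| < 0 and not 0. *)
Lemma Carg_bound (z : C) : z <> 0 -> (- PI < Carg z <= PI)%R.
Proof.
  intros Hz.
  assert (Hb := acos_bound (Re z / Cmod z)).
  unfold Carg; destruct Rlt_dec as [H|H]; [|pose proof PI_RGT_0; lra].
  split; [|pose proof PI_RGT_0; lra].
  destruct (Rle_lt_or_eq_dec _ _ (proj2 Hb)) as [Hlt|He]; [lra|exfalso].
  pose proof (sin_Carg z Hz) as Hs.
  unfold Carg in Hs; destruct Rlt_dec; [|lra].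
  rewrite He, sin_neg, sin_PI in Hs.
  apply Cmod_gt_0 in Hz.
  assert (Im z / Cmod z < 0)%R by (apply Rlt_div_l; lra).
  lra.
Qed.

Lemma Cexp_Clog (z : C) : z <> 0 -> Cexp (Clog z) = z.
Proof.
  intros Hz; unfold Cexp, Clog; simpl.
  rewrite cos_Carg, sin_Carg by exact Hz.
  apply Cmod_gt_0 in Hz; rewrite exp_ln by exact Hz.
  destruct z as [x y]; apply injective_projections; simpl in *; field; lra.
Qed.

Lemma C_neq_0_of_Re_pos (z : C) : (0 < Re z)%R -> z <> 0.
Proof. intros H ->; simpl in H; lra. Qed.

Lemma Re_pos_near (z w : C) : (Cmod (w - z) < Re z)%R -> (0 < Re w)%R.
Proof.
  intros Hw; pose proof (re_le_Cmod (w - z)) as H; apply Rabs_le_between in H.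
  replace (Re (w - z)) with (Re w - Re z)%R in H by (destruct w, z; simpl; ring).
  lra.
Qed.

(** A single formula on the right half-plane, whereas [Carg] switches cases at the real axis;
    continuity of [Clog] is read off from it. *)
Lemma Carg_atan (z : C) : (0 < Re z)%R -> Carg z = atan (Im z / Re z).
Proof.
  intros Hz; pose proof (C_neq_0_of_Re_pos z Hz) as Hz0.
  pose proof (sin_Carg z Hz0) as Hs; pose proof (cos_Carg z Hz0) as Hc.
  pose proof (proj1 (Cmod_gt_0 z) Hz0) as Hm.
  assert (Hcp : (0 < cos (Carg z))%R) by (rewrite Hc; now apply Rdiv_lt_0_compat).
  assert (Hb : (- (PI / 2) < Carg z < PI / 2)%R).
  { pose proof (Carg_bound z Hz0).
    destruct (Rlt_le_dec (- (PI / 2)) (Carg z)) as [H1|H1].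
    - destruct (Rlt_le_dec (Carg z) (PI / 2)) as [H2|H2]; [now split|].
      pose proof (cos_le_0 (Carg z) H2); lra.
    - assert (H2 := cos_le_0 (- Carg z)); rewrite cos_neg in H2; lra. }
  rewrite <- (atan_tan (Carg z) Hb); f_equal; unfold tan; rewrite Hs, Hc; field; lra.
Qed.

Lemma Clog_continuous (z : C) : (0 < Re z)%R ->
  forall eps : R, (0 < eps)%R -> exists d : R, (0 < d)%R /\
    forall w : C, (Cmod (w - z) < d)%R -> (Cmod (Clog w - Clog z) < eps)%R.
Proof.
  intros Hz eps Heps.
  pose proof (proj1 (Cmod_gt_0 z) (C_neq_0_of_Re_pos z Hz)) as Hm.
  assert (HRe : continuous (Re : C_UniformSpace -> R_UniformSpace) z) by apply continuous_fst.
  assert (HIm : continuous (Im : C_UniformSpace -> R_UniformSpace) z) by apply continuous_snd.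
  assert (Hcm : continuous (Cmod : C_UniformSpace -> R_UniformSpace) z).
  { apply (filterlim_norm (V := C_NormedModule)). }
  assert (Hln : continuous (fun w : C_UniformSpace => ln (Cmod w)) z).
  { apply (continuous_comp Cmod ln); [exact Hcm | now apply continuous_ln]. }
  assert (Hat : continuous (fun w : C_UniformSpace => atan (Im w / Re w)) z).
  { apply (continuous_comp (fun w : C_UniformSpace => (Im w / Re w)%R) atan).
    - apply (continuous_mult (K := R_AbsRing) (fun w : C_UniformSpace => Im w) (fun w => / Re w)%R).
      + exact HIm.
      + apply (continuous_comp Re Rinv); [exact HRe|].
        apply continuous_Rinv; lra.
    - apply continuous_atan. }
  assert (He : (0 < eps / 2)%R) by lra.
  assert (L1 := Hln _ (locally_ball (ln (Cmod z)) (mkposreal _ He))).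
  assert (L2 := Hat _ (locally_ball (atan (Im z / Re z)) (mkposreal _ He))).
  apply locally_Cmod in L1; apply locally_Cmod in L2.
  destruct L1 as [d1 [Hd1 L1]], L2 as [d2 [Hd2 L2]].
  exists (Rmin (Re z) (Rmin d1 d2)); split; [repeat apply Rmin_glb_lt; assumption|].
  intros w Hw.
  pose proof (Rmin_l (Re z) (Rmin d1 d2)); pose proof (Rmin_r (Re z) (Rmin d1 d2)).
  pose proof (Rmin_l d1 d2); pose proof (Rmin_r d1 d2).
  assert (Hw' : (0 < Re w)%R) by (apply (Re_pos_near z); lra).
  specialize (L1 w ltac:(lra)); specialize (L2 w ltac:(lra)).
  change (Rabs (ln (Cmod w) - ln (Cmod z)) < eps / 2)%R in L1.
  change (Rabs (atan (Im w / Re w) - atan (Im z / Re z)) < eps / 2)%R in L2.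
  rewrite <- !Carg_atan in L2 by assumption.
  eapply Rle_lt_trans; [apply Cmod_le_Rabs_Re_Im|].
  unfold Clog; simpl; unfold Rminus in *; lra.
Qed.

(** A continuous right inverse of a function with nonzero derivative is differentiable: with G and h
    the increments of g and of its argument, h = G l + o(G), which first bounds |G| by a multiple of
    |h| and then gives G = h / l + o(h). *)
Lemma is_Cderive_inverse (f g : C -> C) (z l : C) (r : R) :
  is_Cderive f (g z) l -> l <> 0 ->
  (0 < r)%R -> (forall w, (Cmod (w - z) < r)%R -> f (g w) = w) ->
  (forall eps : R, (0 < eps)%R -> exists d : R, (0 < d)%R /\
     forall w : C, (Cmod (w - z) < d)%R -> (Cmod (g w - g z) < eps)%R) ->
  is_Cderive g z (/ l).
Proof.
  intros Hf Hl Hr Hfg Hg; apply is_Cderive_eps; intros eps Heps.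
  pose proof (proj1 (Cmod_gt_0 l) Hl) as Hml.
  set (m := Cmod l) in *.
  (* The bound m/2 absorbs the error e |G| and yields |G| <= 2 |h| / m; the other bound then makes e
     |G| / m at most eps |h|. *)
  set (e := Rmin (m / 2) (eps * m * m / 2)).
  assert (He : (0 < e)%R).
  { apply Rmin_glb_lt; [lra|].
    apply Rmult_lt_0_compat; [|lra]; repeat apply Rmult_lt_0_compat; assumption. }
  assert (He1 : (e <= m / 2)%R) by apply Rmin_l.
  assert (He2 : (e <= eps * m * m / 2)%R) by apply Rmin_r.
  clearbody e.
  destruct (proj1 (is_Cderive_eps _ _ _) Hf e He) as [d1 [Hd1 H1]].
  destruct (Hg d1 Hd1) as [d2 [Hd2 H2]].
  exists (Rmin r d2); split; [now apply Rmin_glb_lt|].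
  intros w Hw.
  assert (Hw1 := Rlt_le_trans _ _ _ Hw (Rmin_l _ _)).
  assert (Hw2 := Rlt_le_trans _ _ _ Hw (Rmin_r _ _)).
  specialize (H1 (g w) (H2 w Hw2)).
  rewrite (Hfg w Hw1), (Hfg z) in H1
    by (replace (z - z) with (RtoC 0) by ring; rewrite Cmod_0; exact Hr).
  set (G := g w - g z) in *; set (h := w - z) in *.
  assert (HG : (m * Cmod G <= Cmod h + e * Cmod G)%R).
  { unfold m; rewrite Rmult_comm, <- Cmod_mult.
    replace (G * l) with (h + - (h - G * l)) by ring.
    eapply Rle_trans; [apply Cmod_triangle|]; rewrite Cmod_opp; lra. }
  pose proof (Cmod_ge_0 G); pose proof (Cmod_ge_0 h).
  assert (HG2 : (Cmod G <= 2 / m * Cmod h)%R).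
  { replace (2 / m * Cmod h)%R with (2 * Cmod h / m)%R by (field; lra).
    apply Rle_div_r; nra. }
  replace (G - h * / l) with (- (h - G * l) / l) by (field; exact Hl).
  rewrite Cmod_div, Cmod_opp by exact Hl.
  apply Rle_div_l; [exact Hml|].
  eapply Rle_trans; [exact H1|].
  apply Rle_trans with (eps * m * m / 2 * (2 / m * Cmod h))%R.
  - apply Rmult_le_compat; lra.
  - right; fold m; field; lra.
Qed.

Lemma is_Cderive_Clog (z : C) : (0 < Re z)%R -> is_Cderive Clog z (/ z).
Proof.
  intros Hz.
  apply (is_Cderive_inverse Cexp Clog z z (Re z)).
  - rewrite <- (Cexp_Clog z) at 2 by now apply C_neq_0_of_Re_pos.
    apply is_Cderive_Cexp.
  - now apply C_neq_0_of_Re_pos.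
  - exact Hz.
  - intros w Hw; apply Cexp_Clog, C_neq_0_of_Re_pos, (Re_pos_near z), Hw.
  - now apply Clog_continuous.
Qed.

(** * The principal square root *)

Lemma Csqrt_Cexp (z : C) : z <> 0 -> Csqrt z = Cexp (1 / 2 * Clog z).
Proof. intros Hz; unfold Csqrt; now destruct (Ceq_dec z 0). Qed.

Lemma Csqrt_0 : Csqrt 0 = 0.
Proof. unfold Csqrt; now destruct (Ceq_dec 0 0). Qed.

Lemma Csqrt_sqr (z : C) : Csqrt z * Csqrt z = z.
Proof.
  destruct (Ceq_dec z 0) as [->|Hz]; [rewrite Csqrt_0; ring|].
  rewrite Csqrt_Cexp, <- Cexp_plus by exact Hz.
  rewrite <- (Cexp_Clog z Hz) at 3; f_equal; field.
Qed.

Lemma Csqrt_neq_0 (z : C) : z <> 0 -> Csqrt z <> 0.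
Proof. intros Hz H; apply Hz; rewrite <- (Csqrt_sqr z), H; ring. Qed.

Lemma Cmod_Csqrt (z : C) : Cmod (Csqrt z) = sqrt (Cmod z).
Proof.
  rewrite <- (Csqrt_sqr z) at 2; rewrite Cmod_mult, sqrt_square; [reflexivity|apply Cmod_ge_0].
Qed.

Lemma Cmod_Csqrt_lt_1 (z : C) : (Cmod z < 1)%R -> (Cmod (Csqrt z) < 1)%R.
Proof.
  intros Hz; rewrite Cmod_Csqrt, <- sqrt_1; apply sqrt_lt_1; [apply Cmod_ge_0|lra|exact Hz].
Qed.

(* The range of the principal square root, with the half-line of values of
   negative reals on the positive imaginary axis. *)
Definition principal_half_plane (w : C) : Prop :=
  (0 < Re w)%R \/ (Re w = 0%R /\ (0 <= Im w)%R).

Lemma Csqrt_principal (z : C) : principal_half_plane (Csqrt z).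
Proof.
  destruct (Ceq_dec z 0) as [->|Hz]; [rewrite Csqrt_0; right; simpl; lra|].
  rewrite Csqrt_Cexp by exact Hz.
  pose proof (Carg_bound z Hz) as Hb.
  unfold principal_half_plane, Cexp.
  set (x := Re (1 / 2 * Clog z)).
  replace (Im (1 / 2 * Clog z)) with (Carg z / 2)%R by (unfold Clog; simpl; field).
  simpl; pose proof (exp_pos x).
  destruct (Rle_lt_or_eq_dec _ _ (proj2 Hb)) as [Hlt|He].
  - left; apply Rmult_lt_0_compat; [assumption | apply cos_gt_0; lra].
  - right; rewrite He, cos_PI2, sin_PI2; lra.
Qed.

Lemma Csqr_eq (a b : C) : a * a = b * b -> a = b \/ a = - b.
Proof.
  intros H.
  assert (H' : (a - b) * (a + b) = 0).
  { replace ((a - b) * (a + b)) with (a * a - b * b) by ring; rewrite H; ring. }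
  destruct (Ceq_dec (a - b) 0) as [H1|H1].
  - left; replace a with (a - b + b) by ring; rewrite H1; ring.
  - destruct (Ceq_dec (a + b) 0) as [H2|H2].
    + right; replace a with (a + b - b) by ring; rewrite H2; ring.
    + now destruct (Cmult_neq_0 _ _ H1 H2).
Qed.

(** Two square roots of z differ at most in sign, and the half-plane contains both w and -w only for
    w = 0. *)
Lemma Csqrt_unique (w z : C) : w * w = z -> principal_half_plane w -> Csqrt z = w.
Proof.
  intros <- Hw; pose proof (Csqrt_principal (w * w)) as Hs.
  destruct (Csqr_eq _ _ (Csqrt_sqr (w * w))) as [H|H]; [exact H|].
  rewrite H in *; destruct w as [x y]; unfold principal_half_plane in *; simpl in *.
  apply injective_projections; simpl; lra.
Qed.

Lemma Csqrt_1 : Csqrt 1 = 1.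
Proof. apply Csqrt_unique; [ring | left; simpl; lra]. Qed.

(** A purely imaginary root would have a square with nonpositive real part. *)
Lemma Csqrt_Re_pos (z : C) : (0 < Re z)%R -> (0 < Re (Csqrt z))%R.
Proof.
  intros Hz; destruct (Csqrt_principal z) as [H|[H _]]; [exact H|].
  rewrite <- (Csqrt_sqr z) in Hz; destruct (Csqrt z) as [x y]; simpl in *; subst; nra.
Qed.

Lemma is_Cderive_Csqrt (z : C) : (0 < Re z)%R -> is_Cderive Csqrt z (/ (2 * Csqrt z)).
Proof.
  intros Hz; pose proof (C_neq_0_of_Re_pos z Hz) as Hz0.
  pose proof (Csqrt_neq_0 z Hz0) as Hs.
  apply (is_Cderive_ext_loc (fun w => Cexp (1 / 2 * Clog w)) _ _ _ (Re z) Hz).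
  { intros w Hw; symmetry; apply Csqrt_Cexp, C_neq_0_of_Re_pos, (Re_pos_near z), Hw. }
  eapply is_Cderive_value.
  - apply (is_Cderive_comp Cexp (fun w => 1 / 2 * Clog w)); [apply is_Cderive_Cexp|].
    apply is_Cderive_mult; [apply is_Cderive_const | apply is_Cderive_Clog, Hz].
  - cbv beta; rewrite <- Csqrt_Cexp by exact Hz0.
    rewrite <- (Csqrt_sqr z) at 2; field; exact Hs.
Qed.

Lemma Re_one_minus_pos (z : C) : (Cmod z < 1)%R -> (0 < Re (1 - z))%R.
Proof.
  intros Hz; pose proof (re_le_Cmod z) as H; apply Rabs_le_between in H.
  destruct z; simpl in *; lra.
Qed.

(* With sqrt z = a + bi and sqrt (1 - z) = c + di, comparing imaginary parts gives
   cd = -ab, so c Re (sqrt z sqrt (1 - z)) = a (b^2 + c^2) >= 0. *)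
Lemma Csqrt_mult_one_minus (z : C) : (Cmod z < 1)%R ->
  Csqrt (z * (1 - z)) = Csqrt z * Csqrt (1 - z).
Proof.
  intros Hz; apply Csqrt_unique.
  - rewrite <- (Csqrt_sqr z) at 5; rewrite <- (Csqrt_sqr (1 - z)) at 3; ring.
  - pose proof (Csqrt_Re_pos _ (Re_one_minus_pos z Hz)) as Hc.
    pose proof (Csqrt_principal z) as Hs.
    assert (E : Csqrt (1 - z) * Csqrt (1 - z) + Csqrt z * Csqrt z = 1)
      by (rewrite !Csqrt_sqr; ring).
    destruct (Csqrt z) as [a b], (Csqrt (1 - z)) as [c d].
    apply (f_equal Im) in E; unfold principal_half_plane in *; simpl in *.
    assert (Hcd : (c * d = - (a * b))%R) by lra.
    destruct Hs as [Ha|[Ha Hb]].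
    + left.
      assert (0 < c * (a * c - b * d))%R; [|nra].
      replace (c * (a * c - b * d))%R with (a * (c * c) - b * (c * d))%R by ring.
      rewrite Hcd; replace (a * (c * c) - b * - (a * b))%R with (a * (c * c + b * b))%R by ring.
      apply Rmult_lt_0_compat; [exact Ha | nra].
    (* Here z is a nonpositive real. Since c > 0, cd = 0 forces d = 0, and the product is i b c with
       b >= 0. *)
    + right; subst a.
      assert (d = 0)%R by nra; subst d; nra.
Qed.

(** * The arcsine, its cosine and its exponential on the unit disc *)

Definition cosarcsin (s : C) : C := Csqrt (1 - s * s).

Lemma cosarcsin_sqr (s : C) : cosarcsin s * cosarcsin s = 1 - s * s.
Proof. apply Csqrt_sqr. Qed.

Lemma cosarcsin_opp (s : C) : cosarcsin (- s) = cosarcsin s.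
Proof. unfold cosarcsin; f_equal; ring. Qed.

Lemma cosarcsin_0 : cosarcsin 0 = 1.
Proof.
  unfold cosarcsin; replace (1 - 0 * 0) with (RtoC 1) by ring; apply Csqrt_1.
Qed.

Lemma Cmod_sqr_lt_1 (s : C) : (Cmod s < 1)%R -> (Cmod (s * s) < 1)%R.
Proof. intros Hs; rewrite Cmod_mult; pose proof (Cmod_ge_0 s); nra. Qed.

Lemma Re_cosarcsin_pos (s : C) : (Cmod s < 1)%R -> (0 < Re (cosarcsin s))%R.
Proof. intros Hs; apply Csqrt_Re_pos, Re_one_minus_pos, Cmod_sqr_lt_1, Hs. Qed.

Lemma cosarcsin_neq_0 (s : C) : (Cmod s < 1)%R -> cosarcsin s <> 0.
Proof. intros Hs; apply C_neq_0_of_Re_pos, Re_cosarcsin_pos, Hs. Qed.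

Lemma is_Cderive_cosarcsin (s : C) : (Cmod s < 1)%R ->
  is_Cderive cosarcsin s (- s / cosarcsin s).
Proof.
  intros Hs; eapply is_Cderive_value.
  - apply (is_Cderive_comp Csqrt (fun w => 1 - w * w)).
    + apply is_Cderive_Csqrt, Re_one_minus_pos, Cmod_sqr_lt_1, Hs.
    + apply is_Cderive_minus; [apply is_Cderive_const|].
      apply is_Cderive_mult; apply is_Cderive_id.
  - cbv beta; fold (cosarcsin s); field; apply cosarcsin_neq_0, Hs.
Qed.

(* exp (i arcsin s) *)
Definition expiarcsin (s : C) : C := Ci * s + cosarcsin s.

Lemma Ci_sqr : Ci * Ci = - (1).
Proof. apply injective_projections; simpl; ring. Qed.

Lemma Ci_neq_0 : Ci <> 0.
Proof. intros H; injection H; lra. Qed.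

(** As [cosarcsin] is even, the product is c^2 + s^2. So [expiarcsin (- s)] stands for exp (-i
    arcsin s), with no appeal to the oddness of the principal arcsine. *)
Lemma expiarcsin_opp (s : C) : expiarcsin (- s) * expiarcsin s = 1.
Proof.
  unfold expiarcsin; rewrite cosarcsin_opp.
  replace ((Ci * - s + cosarcsin s) * (Ci * s + cosarcsin s))
    with (cosarcsin s * cosarcsin s - Ci * Ci * (s * s)) by ring.
  rewrite cosarcsin_sqr, Ci_sqr; ring.
Qed.

Lemma expiarcsin_neq_0 (s : C) : expiarcsin s <> 0.
Proof.
  intros H; apply C1_nz; rewrite <- (expiarcsin_opp s), H; ring.
Qed.

(** With s = a + bi and c = p + qi the real part is p - b. From c^2 = 1 - s^2 one gets p^2 = b^2 +
    q^2 + 1 - a^2 > b^2, which together with p > 0 excludes p <= b. The logarithm in the arcsine is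
    thus taken where it is holomorphic. *)
Lemma Re_expiarcsin_pos (s : C) : (Cmod s < 1)%R -> (0 < Re (expiarcsin s))%R.
Proof.
  intros Hs; pose proof (Re_cosarcsin_pos s Hs) as Hc.
  pose proof (cosarcsin_sqr s) as E; pose proof (Cmod2_alt s) as Hm.
  pose proof (Cmod_ge_0 s).
  unfold expiarcsin; destruct s as [a b], (cosarcsin (a, b)) as [p q].
  apply (f_equal Re) in E; simpl in *.
  assert (a * a + b * b < 1)%R by nra.
  destruct (Rlt_le_dec b p); [lra|].
  assert (p * p <= b * b)%R by nra.
  nra.
Qed.

Lemma Carcsin_alt (s : C) : Carcsin s = - Ci * Clog (expiarcsin s).
Proof.
  unfold Carcsin, expiarcsin, cosarcsin.
  replace (1 - s ^ 2) with (1 - s * s) by (simpl; ring); reflexivity.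
Qed.

Lemma Cexp_iCarcsin (s : C) : Cexp (Ci * Carcsin s) = expiarcsin s.
Proof.
  rewrite Carcsin_alt.
  replace (Ci * (- Ci * Clog (expiarcsin s))) with (- (Ci * Ci) * Clog (expiarcsin s)) by ring.
  rewrite Ci_sqr; replace (- - (1) * Clog (expiarcsin s)) with (Clog (expiarcsin s)) by ring.
  apply Cexp_Clog, expiarcsin_neq_0.
Qed.

Lemma Cexp_opp_iCarcsin (s : C) : Cexp (- (Ci * Carcsin s)) = expiarcsin (- s).
Proof.
  rewrite Cexp_opp, Cexp_iCarcsin.
  rewrite <- (Cmult_1_l (/ _)), <- (expiarcsin_opp s); field; apply expiarcsin_neq_0.
Qed.

Lemma Clog_1 : Clog 1 = 0.
Proof.
  unfold Clog; rewrite Cmod_1, ln_1, Carg_atan by (simpl; lra); simpl.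
  replace (0 / 1)%R with 0%R by field; now rewrite atan_0.
Qed.

Lemma Carcsin_0 : Carcsin 0 = 0.
Proof.
  rewrite Carcsin_alt; unfold expiarcsin; rewrite cosarcsin_0.
  replace (Ci * 0 + 1) with (RtoC 1) by ring; rewrite Clog_1; ring.
Qed.

(** The derivative of is + c is i (is + c) / c, so its logarithmic derivative is i / c, and the
    factor -i leaves 1 / c. *)
Lemma is_Cderive_Carcsin (s : C) : (Cmod s < 1)%R ->
  is_Cderive Carcsin s (/ cosarcsin s).
Proof.
  intros Hs.
  apply (is_Cderive_ext_loc (fun w => - Ci * Clog (expiarcsin w)) _ _ _ 1 Rlt_0_1).
  { intros w _; symmetry; apply Carcsin_alt. }
  eapply is_Cderive_value.
  - apply is_Cderive_mult; [apply is_Cderive_const|].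
    apply (is_Cderive_comp Clog expiarcsin); [apply is_Cderive_Clog, Re_expiarcsin_pos, Hs|].
    apply is_Cderive_plus; [|apply is_Cderive_cosarcsin, Hs].
    apply is_Cderive_mult; [apply is_Cderive_const | apply is_Cderive_id].
  - cbv beta; pose proof (cosarcsin_neq_0 s Hs) as Hc.
    pose proof (expiarcsin_neq_0 s) as He; unfold expiarcsin in *.
    assert (E : 0 * s + Ci * 1 + - s / cosarcsin s
                = Ci * (Ci * s + cosarcsin s) / cosarcsin s).
    { replace (Ci * (Ci * s + cosarcsin s)) with (Ci * Ci * s + Ci * cosarcsin s) by ring.
      rewrite Ci_sqr; field; exact Hc. }
    rewrite E.
    replace (/ cosarcsin s) with (- (Ci * Ci) / cosarcsin s) by (rewrite Ci_sqr; field; exact Hc).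
    field; split; assumption.
Qed.

(** * Finite sums and the binomial theorem *)

Definition Csum (f : nat -> C) (N : nat) : C := sum_n (G := C_AbelianMonoid) f N.

Lemma Csum_0 (f : nat -> C) : Csum f 0 = f 0%nat.
Proof. exact (sum_O (G := C_AbelianMonoid) f). Qed.

Lemma Csum_S (f : nat -> C) (N : nat) : Csum f (S N) = Csum f N + f (S N).
Proof. exact (sum_Sn (G := C_AbelianMonoid) f N). Qed.

Lemma Csum_ext (f g : nat -> C) (N : nat) :
  (forall k, (k <= N)%nat -> f k = g k) -> Csum f N = Csum g N.
Proof. apply (sum_n_ext_loc (G := C_AbelianMonoid)). Qed.

Lemma Csum_scal (a : C) (f : nat -> C) (N : nat) :
  Csum (fun k => a * f k) N = a * Csum f N.
Proof.
  induction N as [|N IH]; [now rewrite !Csum_0 | rewrite !Csum_S, IH; ring].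
Qed.

Lemma Csum_plus (f g : nat -> C) (N : nat) :
  Csum (fun k => f k + g k) N = Csum f N + Csum g N.
Proof.
  induction N as [|N IH]; [now rewrite !Csum_0 | rewrite !Csum_S, IH; ring].
Qed.

(** Used to put the arcsine term of the bracket into the vacant place k = n, so that differentiation
    produces a complete binomial sum. *)
Lemma Csum_replace_term (f : nat -> C) (b : C) (n N : nat) :
  Csum (fun k => if Nat.eqb k n then b else f k) N
  = (if Nat.leb n N then b else 0) + Csum (fun k => if Nat.eqb k n then 0 else f k) N.
Proof.
  induction N as [|N IH].
  - rewrite !Csum_0; destruct n; simpl; ring.
  - rewrite !Csum_S, IH.
    destruct (Nat.eqb_spec (S N) n) as [He|He], (Nat.leb_spec n N), (Nat.leb_spec n (S N));
      try lia; ring.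
Qed.

Lemma is_Cderive_Csum (f df : nat -> C -> C) (z : C) (N : nat) :
  (forall k, (k <= N)%nat -> is_Cderive (f k) z (df k z)) ->
  is_Cderive (fun w => Csum (fun k => f k w) N) z (Csum (fun k => df k z) N).
Proof.
  intros H; induction N as [|N IH].
  - rewrite Csum_0; apply (is_Cderive_ext_loc (f 0%nat) _ _ _ 1 Rlt_0_1).
    + intros w _; symmetry; apply Csum_0.
    + apply H; lia.
  - rewrite Csum_S.
    apply (is_Cderive_ext_loc (fun w => Csum (fun k => f k w) N + f (S N) w) _ _ _ 1 Rlt_0_1).
    + intros w _; symmetry; apply Csum_S.
    + apply is_Cderive_plus; [apply IH; intros k Hk | ]; apply H; lia.
Qed.

Lemma binomial_0 (n : nat) : Binomial.C n 0 = 1%R.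
Proof. unfold Binomial.C; rewrite Nat.sub_0_r; simpl; field; apply INR_fact_neq_0. Qed.

Lemma binomial_diag (n : nat) : Binomial.C n n = 1%R.
Proof. unfold Binomial.C; rewrite Nat.sub_diag; simpl; field; apply INR_fact_neq_0. Qed.

(** Pascal's rule summed over k. Truncating at m makes induction possible with n fixed; the extra
    term on the left is the one whose second Pascal neighbour lies beyond the truncation. *)
Lemma Csum_pascal (T : nat -> C) (n m : nat) : (m <= n)%nat ->
  Csum (fun k => RtoC (Binomial.C (S n) k) * T k) m + RtoC (Binomial.C n m) * T (S m)
  = Csum (fun k => RtoC (Binomial.C n k) * T k) m
    + Csum (fun k => RtoC (Binomial.C n k) * T (S k)) m.
Proof.
  induction m as [|m IH]; intros Hm.
  - rewrite !Csum_0, !binomial_0; ring.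
  - rewrite !Csum_S, <- pascal, RtoC_plus by lia.
    assert (E := IH ltac:(lia)).
    match type of E with ?a + ?b = ?c + ?d =>
      replace d with (a + b - c) by (rewrite E; ring) end.
    ring.
Qed.

Lemma Cbinomial (x y : C) (n : nat) :
  (x + y) ^ n = Csum (fun k => RtoC (Binomial.C n k) * (x ^ (n - k) * y ^ k)) n.
Proof.
  induction n as [|n IH].
  - rewrite Csum_0, binomial_0; simpl; ring.
  - rewrite Csum_S, binomial_diag, <- (binomial_diag n).
    rewrite (Csum_pascal (fun k => x ^ (S n - k) * y ^ k)) by lia.
    rewrite Cpow_S, IH, Cmult_plus_distr_r; f_equal; rewrite <- Csum_scal;
      apply Csum_ext; intros k Hk.
    + replace (S n - k)%nat with (S (n - k)) by lia; rewrite Cpow_S; ring.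
    + replace (S n - S k)%nat with (n - k)%nat by lia; rewrite Cpow_S; ring.
Qed.

(** * The bracket: derivative, oddness, reduction formula *)

Lemma is_Cderive_Csin (z : C) :
  is_Cderive Csin z ((Cexp (Ci * z) + Cexp (- (Ci * z))) / 2).
Proof.
  assert (H : is_Cderive (fun w => Ci * w) z Ci).
  { eapply is_Cderive_value.
    - apply is_Cderive_mult; [apply is_Cderive_const | apply is_Cderive_id].
    - cbv beta; ring. }
  unfold Csin; eapply is_Cderive_value.
  - apply is_Cderive_div; [|apply is_Cderive_const|].
    + apply is_Cderive_minus.
      * apply (is_Cderive_comp Cexp (fun w => Ci * w)); [apply is_Cderive_Cexp | exact H].
      * apply (is_Cderive_comp Cexp (fun w => - (Ci * w))); [apply is_Cderive_Cexp|].
        apply (is_Cderive_ext_loc (fun w => 0 - Ci * w) _ _ _ 1 Rlt_0_1); [intros; ring|].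
        apply is_Cderive_minus; [apply is_Cderive_const | exact H].
    + apply Cmult_neq_0; [|apply Ci_neq_0]; intros E; injection E; lra.
  - cbv beta; field; apply Ci_neq_0.
Qed.

(* The bracket of the theorem at sqrt z = s; its k-th term is the primitive
   vanishing at 0 of (-1)^k binom(2n,k) cos (2 (n - k) t), taken at t = arcsin s. *)
Definition bracket (n : nat) (s : C) : C :=
  RtoC ((-1) ^ n * Binomial.C (2 * n) n)%R * Carcsin s
  + Csum (fun k : nat =>
      if Nat.eqb k n then RtoC 0
      else RtoC ((-1) ^ k * Binomial.C (2 * n) k)%R
           * (Csin (RtoC (2 * (INR n - INR k))%R * Carcsin s)
              / RtoC (2 * (INR n - INR k))%R)) (2 * n).

(** The splitting 2(n - k) = (2n - k) - k gives the monomial shape required by the binomial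
    theorem. *)
Lemma Cexp_iCarcsin_multiple (n k : nat) (s : C) : (k <= 2 * n)%nat ->
  Cexp (Ci * (RtoC (2 * (INR n - INR k))%R * Carcsin s))
  = expiarcsin s ^ (2 * n - k) * expiarcsin (- s) ^ k.
Proof.
  intros Hk.
  rewrite <- (Cexp_opp_iCarcsin s), <- (Cexp_iCarcsin s), <- !Cexp_INR_mult, <- Cexp_plus.
  rewrite minus_INR, mult_INR by exact Hk; f_equal.
  replace (INR 2) with 2%R by (simpl; ring).
  rewrite !RtoC_minus, !RtoC_mult, !RtoC_minus; ring.
Qed.

Lemma Cexp_opp_iCarcsin_multiple (n k : nat) (s : C) : (k <= 2 * n)%nat ->
  Cexp (- (Ci * (RtoC (2 * (INR n - INR k))%R * Carcsin s)))
  = expiarcsin (- s) ^ (2 * n - k) * expiarcsin s ^ k.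
Proof.
  intros Hk.
  rewrite <- (Cexp_opp_iCarcsin s), <- (Cexp_iCarcsin s), <- !Cexp_INR_mult, <- Cexp_plus.
  rewrite minus_INR, mult_INR by exact Hk; f_equal.
  replace (INR 2) with 2%R by (simpl; ring).
  rewrite !RtoC_minus, !RtoC_mult, !RtoC_minus; ring.
Qed.

(** The expansion of (x - y)^{2n}. As a power of a square it is visibly symmetric in x and y, and
    the square can be evaluated separately. *)
Lemma Csum_alternating_binomial (x y : C) (n : nat) :
  Csum (fun k => RtoC ((-1) ^ k * Binomial.C (2 * n) k)%R * (x ^ (2 * n - k) * y ^ k)) (2 * n)
  = ((x - y) * (x - y)) ^ n.
Proof.
  replace (((x - y) * (x - y)) ^ n) with ((x + - (1) * y) ^ (2 * n)).
  2:{ rewrite Cpow_mult_r; f_equal; simpl; ring. }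
  rewrite Cbinomial; apply Csum_ext; intros k Hk.
  replace (- (1)) with (RtoC (-1)) by (apply injective_projections; simpl; ring).
  rewrite Cpow_mult_l, RtoC_mult, RtoC_pow; ring.
Qed.

Lemma RtoC_neq_0 (x : R) : x <> 0%R -> RtoC x <> 0.
Proof. intros H E; injection E; exact H. Qed.

Lemma is_Cderive_bracket (n : nat) (s : C) : (Cmod s < 1)%R ->
  is_Cderive (bracket n) s ((- (4) * (s * s)) ^ n / cosarcsin s).
Proof.
  intros Hs; pose proof (cosarcsin_neq_0 s Hs) as Hc.
  set (a := fun k => RtoC ((-1) ^ k * Binomial.C (2 * n) k)%R).
  set (m := fun k => RtoC (2 * (INR n - INR k))%R).
  set (f := fun k w => if Nat.eqb k n then a n * Carcsin w
                       else a k * (Csin (m k * Carcsin w) / m k)).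
  set (P := fun k => expiarcsin s ^ (2 * n - k) * expiarcsin (- s) ^ k).
  set (Q := fun k => expiarcsin (- s) ^ (2 * n - k) * expiarcsin s ^ k).
  (* The cosine of 2(n - k) arcsin s is half of [P k + Q k], and 1 / c is the derivative of the
     arcsine. For k = n both products equal 1, so the arcsine term fits the same formula. *)
  set (df := fun k (_ : C) => / (2 * cosarcsin s) * (a k * P k + a k * Q k)).
  apply (is_Cderive_ext_loc (fun w => Csum (fun k => f k w) (2 * n)) _ _ _ 1 Rlt_0_1).
  { intros w _; unfold f; rewrite Csum_replace_term.
    destruct (Nat.leb_spec n (2 * n)); [reflexivity | lia]. }
  eapply is_Cderive_value.
  - apply (is_Cderive_Csum f df); intros k Hk; unfold f, df.
    destruct (Nat.eqb_spec k n) as [->|Hkn].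
    + eapply is_Cderive_value.
      * apply is_Cderive_mult; [apply is_Cderive_const | apply is_Cderive_Carcsin, Hs].
      * unfold P, Q; replace (2 * n - n)%nat with n by lia.
        rewrite <- !Cpow_mult_l, (Cmult_comm (expiarcsin s)), expiarcsin_opp, Cpow_1_l.
        field; exact Hc.
    + assert (Hm : m k <> 0).
      { apply RtoC_neq_0; intros E; apply Hkn, INR_eq; lra. }
      eapply is_Cderive_value.
      * apply is_Cderive_mult; [apply is_Cderive_const|].
        apply is_Cderive_div; [|apply is_Cderive_const|exact Hm].
        apply (is_Cderive_comp Csin (fun w => m k * Carcsin w)); [apply is_Cderive_Csin|].
        apply is_Cderive_mult; [apply is_Cderive_const | apply is_Cderive_Carcsin, Hs].
      * cbv beta; unfold m in *.
        rewrite Cexp_iCarcsin_multiple, Cexp_opp_iCarcsin_multiple by exact Hk.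
        fold (P k) (Q k); field; split; assumption.
  - unfold df; rewrite Csum_scal, Csum_plus; unfold a, P, Q.
    rewrite !Csum_alternating_binomial.
    (* The difference of the two exponentials is 2is. *)
    assert (E : (expiarcsin s - expiarcsin (- s)) * (expiarcsin s - expiarcsin (- s))
                = - (4) * (s * s)).
    { unfold expiarcsin; rewrite cosarcsin_opp.
      match goal with |- ?l = _ => replace l with (4 * (Ci * Ci) * (s * s)) by ring end.
      rewrite Ci_sqr; ring. }
    rewrite E.
    replace ((expiarcsin (- s) - expiarcsin s) * (expiarcsin (- s) - expiarcsin s))
      with (- (4) * (s * s)) by (rewrite <- E; ring).
    field; exact Hc.
Qed.

Lemma bracket_0 (n : nat) : bracket n 0 = 0.
Proof.
  unfold bracket; rewrite Carcsin_0, Cmult_0_r, Cplus_0_l.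
  rewrite (Csum_ext _ (fun _ => 0 * 0)).
  - rewrite Csum_scal; ring.
  - intros k _; destruct (Nat.eqb_spec k n) as [|Hkn]; [ring|].
    rewrite Cmult_0_r; unfold Csin.
    replace (Ci * 0) with (RtoC 0) by ring; replace (- RtoC 0) with (RtoC 0) by ring.
    unfold Cdiv; ring.
Qed.

(** The derivative of the bracket is even and the bracket vanishes at 0. *)
Lemma bracket_opp (n : nat) (s : C) : (Cmod s < 1)%R -> bracket n (- s) = - bracket n s.
Proof.
  intros Hs.
  assert (Hneg : forall z, (Cmod z < 1)%R -> is_Cderive (fun w => - w) z (- (1))).
  { intros z _; apply (is_Cderive_ext_loc (fun w => 0 - w) _ _ _ 1 Rlt_0_1); [intros; ring|].
    eapply is_Cderive_value.
    - apply is_Cderive_minus; [apply is_Cderive_const | apply is_Cderive_id].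
    - ring. }
  apply (eq_of_is_Cderive_eq (fun w => bracket n (- w)) (fun w => - bracket n w)
           (fun w => - ((- (4) * (w * w)) ^ n / cosarcsin w))); [| | |exact Hs].
  - intros z Hz; eapply is_Cderive_value.
    + apply (is_Cderive_comp (bracket n) (fun w => - w)); [|now apply Hneg].
      apply is_Cderive_bracket; now rewrite Cmod_opp.
    + cbv beta; rewrite cosarcsin_opp; replace (- z * - z) with (z * z) by ring; ring.
  - intros z Hz.
    apply (is_Cderive_ext_loc (fun w => - (1) * bracket n w) _ _ _ 1 Rlt_0_1); [intros; ring|].
    eapply is_Cderive_value.
    + apply is_Cderive_mult; [apply is_Cderive_const | now apply is_Cderive_bracket].
    + cbv beta; ring.
  - replace (- RtoC 0) with (RtoC 0) by ring; rewrite bracket_0; ring.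
Qed.

(* Integration by parts for the integral of sin^(2n+2). *)
Lemma bracket_S (n : nat) (s : C) : (Cmod s < 1)%R ->
  RtoC (INR (2 * n + 2)) * bracket (S n) s
  = - (4) * (RtoC (INR (2 * n + 1)) * bracket n s
             - (- (4)) ^ n * (s ^ (2 * n + 1) * cosarcsin s)).
Proof.
  intros Hs.
  apply (eq_of_is_Cderive_eq
    (fun w => RtoC (INR (2 * n + 2)) * bracket (S n) w)
    (fun w => - (4) * (RtoC (INR (2 * n + 1)) * bracket n w
                       - (- (4)) ^ n * (w ^ (2 * n + 1) * cosarcsin w)))
    (fun w => RtoC (INR (2 * n + 2)) * ((- (4) * (w * w)) ^ S n / cosarcsin w)));
    [| | |exact Hs].
  - intros z Hz; eapply is_Cderive_value.
    + apply is_Cderive_mult; [apply is_Cderive_const | now apply is_Cderive_bracket].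
    + cbv beta; ring.
  - intros z Hz; pose proof (cosarcsin_neq_0 z Hz) as Hc.
    eapply is_Cderive_value.
    + apply is_Cderive_mult; [apply is_Cderive_const|].
      apply is_Cderive_minus.
      * apply is_Cderive_mult; [apply is_Cderive_const | now apply is_Cderive_bracket].
      * apply is_Cderive_mult; [apply is_Cderive_const|].
        apply is_Cderive_mult; [apply is_Cderive_pow, is_Cderive_id|].
        now apply is_Cderive_cosarcsin.
    + cbv beta; replace (2 * n + 1 - 1)%nat with (2 * n)%nat by lia.
      replace (z ^ (2 * n + 1)) with (z ^ n * z ^ n * z)
        by (rewrite Cpow_add_r, Cpow_1_r, <- Cpow_add_r; do 2 f_equal; lia).
      replace (z ^ (2 * n)) with (z ^ n * z ^ n) by (rewrite <- Cpow_add_r; f_equal; lia).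
      rewrite Cpow_S, !Cpow_mult_l, !plus_INR, !RtoC_plus.
      replace (RtoC (INR 2)) with (RtoC 2) by (f_equal; simpl; ring).
      replace (RtoC (INR 1)) with (RtoC 1) by reflexivity.
      set (c := cosarcsin z) in *; set (N := RtoC (INR (2 * n))).
      (* Once denominators are cleared, the two derivatives agree modulo this relation. *)
      assert (E : z * z = 1 - c * c) by (unfold c; rewrite cosarcsin_sqr; ring).
      field_simplify_eq; [|exact Hc].
      replace (z ^ 2) with (1 - c * c) by (rewrite <- E; simpl; ring).
      cbv beta; simpl; ring.

  - cbv beta; rewrite !bracket_0, Cpow_add_r; simpl; ring.
Qed.

(** * Punctured limits and differentiability at a removable singularity *)

Definition is_Clim (f : C -> C) (a l : C) : Prop :=
  forall eps : R, (0 < eps)%R -> exists d : R, (0 < d)%R /\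
    forall w : C, w <> a -> (Cmod (w - a) < d)%R -> (Cmod (f w - l) < eps)%R.

Lemma is_Clim_filterlim (f : C -> C) (a l : C) :
  is_Clim f a l ->
  filterlim f (locally' (T := C_UniformSpace) a) (locally (T := C_UniformSpace) l).
Proof.
  intros H P HP; apply locally_Cmod in HP; destruct HP as [e [He HP]].
  destruct (H e He) as [d [Hd Hw]].
  apply locally_Cmod; exists d; split; [exact Hd|].
  intros w Hwd Hwa; apply HP, Hw; assumption.
Qed.

Lemma is_Clim_ext (f g : C -> C) (a l : C) (r : R) : (0 < r)%R ->
  (forall w, w <> a -> (Cmod (w - a) < r)%R -> f w = g w) ->
  is_Clim f a l -> is_Clim g a l.
Proof.
  intros Hr Hfg H eps Heps; destruct (H eps Heps) as [d [Hd Hf]].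
  exists (Rmin r d); split; [now apply Rmin_glb_lt|].
  intros w Hwa Hw.
  pose proof (Rmin_l r d); pose proof (Rmin_r r d).
  rewrite <- Hfg by (assumption || lra); apply Hf; [assumption | lra].
Qed.

Lemma is_Clim_is_Cderive (f : C -> C) (z l y : C) :
  is_Cderive f z l -> f z = y -> is_Clim f z y.
Proof.
  intros H <- eps Heps.
  destruct (is_Cderive_continuous f z l H eps Heps) as [d [Hd Hf]].
  exists d; split; [exact Hd | intros w _; apply Hf].
Qed.

Lemma is_Clim_mult (f g : C -> C) (a p q : C) :
  is_Clim f a p -> is_Clim g a q -> is_Clim (fun w => f w * g w) a (p * q).
Proof.
  intros Hf Hg eps Heps.
  pose proof (Cmod_ge_0 p); pose proof (Cmod_ge_0 q).
  set (M := (2 + Cmod p + Cmod q)%R).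
  assert (HM : (0 < M)%R) by (unfold M; lra).
  set (e := Rmin 1 (eps / M)).
  assert (He : (0 < e)%R) by (apply Rmin_glb_lt; [lra | now apply Rdiv_lt_0_compat]).
  assert (He1 : (e <= 1)%R) by apply Rmin_l.
  assert (He2 : (e * M <= eps)%R) by (apply Rle_div_r; [exact HM | apply Rmin_r]).
  destruct (Hf e He) as [d1 [Hd1 H1]], (Hg e He) as [d2 [Hd2 H2]].
  exists (Rmin d1 d2); split; [now apply Rmin_glb_lt|].
  intros w Hwa Hw.
  pose proof (Rmin_l d1 d2); pose proof (Rmin_r d1 d2).
  specialize (H1 w Hwa ltac:(lra)); specialize (H2 w Hwa ltac:(lra)).
  replace (f w * g w - p * q) with ((f w - p) * (g w - q) + (p * (g w - q) + (f w - p) * q))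
    by ring.
  eapply Rle_lt_trans; [apply Cmod_triangle|].
  eapply Rle_lt_trans; [apply Rplus_le_compat_l, Cmod_triangle|].
  rewrite !Cmod_mult.
  set (x := Cmod (f w - p)) in *; set (y := Cmod (g w - q)) in *.
  assert (0 <= x)%R by apply Cmod_ge_0; assert (0 <= y)%R by apply Cmod_ge_0.
  assert (x * y <= e * 1)%R by (apply Rmult_le_compat; lra).
  unfold M in He2; nra.
Qed.

(** The mean value inequality for P u - u l is applied on the segment from tw to w, which avoids 0;
    continuity at 0 makes the remaining piece from 0 to tw cost at most an arbitrary [eta]. *)
Lemma is_Cderive_of_derivative_limit (P P' : C -> C) (l : C) (r : R) : (0 < r)%R ->
  (forall z : C, z <> 0 -> (Cmod z < r)%R -> is_Cderive P z (P' z)) ->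
  is_Clim P 0 (P 0) -> is_Clim P' 0 l -> is_Cderive P 0 l.
Proof.
  intros Hr HP Hc Hl; apply is_Cderive_eps; intros eps Heps.
  destruct (Hl eps Heps) as [d [Hd Hd']].
  exists (Rmin r d); split; [now apply Rmin_glb_lt|].
  intros w Hw.
  pose proof (Rmin_l r d); pose proof (Rmin_r r d).
  replace (w - 0) with w in * by ring.
  destruct (Ceq_dec w 0) as [->|Hw0].
  { replace (P 0 - P 0 - 0 * l) with (RtoC 0) by ring; rewrite Cmod_0; lra. }
  apply le_epsilon; intros eta Heta.
  destruct (Hc (eta / 2)%R ltac:(lra)) as [d' [Hd'0 Hc']].
  pose proof (Cmod_ge_0 w) as Hw1; pose proof (Cmod_ge_0 l) as Hl1.
  assert (Hwl : (0 <= Cmod w * Cmod l)%R) by now apply Rmult_le_pos.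
  (* The three bounds keep t below 1, put tw within d' of 0, and make t |w| |l| at most eta / 2. The
     summands 1 ensure positive denominators and a strict inequality in the second bound. *)
  set (t := Rmin (1 / 2) (Rmin (d' / (1 + Cmod w)) (eta / 2 / (1 + Cmod w * Cmod l)))).
  assert (Ht0 : (0 < t)%R).
  { repeat apply Rmin_glb_lt; [lra | |]; apply Rdiv_lt_0_compat; lra. }
  assert (Ht1 : (t <= 1 / 2)%R) by apply Rmin_l.
  assert (Ht2 : (t * (1 + Cmod w) <= d')%R).
  { apply Rle_div_r; [lra|]; eapply Rle_trans; [apply Rmin_r | apply Rmin_l]. }
  assert (Ht3 : (t * (1 + Cmod w * Cmod l) <= eta / 2)%R).
  { apply Rle_div_r; [lra|]; eapply Rle_trans; [apply Rmin_r | apply Rmin_r]. }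
  clearbody t.
  assert (Htw : Cmod (RtoC t * w) = (t * Cmod w)%R)
    by (rewrite Cmod_mult, Cmod_R, Rabs_right; lra).
  assert (Hseg : (Cmod ((P w - w * l) - (P (RtoC t * w)%C - RtoC t * w * l))
                  <= eps * Cmod (w - RtoC t * w))%R).
  { apply (Cmod_increment_le (fun u => P u - u * l) (fun u => P' u - l)).
    intros x Hx.
    replace (RtoC t * w + RtoC x * (w - RtoC t * w)) with (RtoC (t + x * (1 - t))%R * w)
      by (rewrite RtoC_plus, RtoC_mult, RtoC_minus; ring).
    set (y := (t + x * (1 - t))%R).
    assert (Hy : (0 < y <= 1)%R) by (unfold y; nra).
    assert (Hyw : (Cmod (RtoC y * w) < Rmin r d)%R) by (apply Cmod_scal_lt; lra).
    assert (Hyw0 : RtoC y * w <> 0) by (apply Cmult_neq_0; [apply RtoC_neq_0; lra | exact Hw0]).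
    split.
    - apply is_Cderive_minus; [apply HP; [exact Hyw0 | lra]|].
      eapply is_Cderive_value.
      + apply is_Cderive_mult; [apply is_Cderive_id | apply is_Cderive_const].
      + cbv beta; ring.
    - apply Rlt_le, Hd'; [exact Hyw0|].
      replace (RtoC y * w - 0) with (RtoC y * w) by ring; lra. }
  assert (Htw0 : RtoC t * w <> 0) by (apply Cmult_neq_0; [apply RtoC_neq_0; lra | exact Hw0]).
  assert (Hct : (Cmod (P (RtoC t * w)%C - P 0) < eta / 2)%R).
  { apply Hc'; [exact Htw0|].
    replace (RtoC t * w - 0) with (RtoC t * w) by ring; rewrite Htw; lra. }
  assert (Hstep : (Cmod (w - RtoC t * w) <= Cmod w)%R).
  { replace (w - RtoC t * w) with (RtoC (1 - t)%R * w) by (rewrite RtoC_minus; ring).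
    rewrite Cmod_mult, Cmod_R, Rabs_right by lra; nra. }
  replace (P w - P 0 - w * l)
    with ((P w - w * l - (P (RtoC t * w) - RtoC t * w * l))
          + (P (RtoC t * w) - P 0 + - (RtoC t * w * l))) by ring.
  eapply Rle_trans; [apply Cmod_triangle|].
  apply Rplus_le_compat.
  - eapply Rle_trans; [exact Hseg|]; apply Rmult_le_compat_l; lra.
  - eapply Rle_trans; [apply Cmod_triangle|].
    rewrite Cmod_opp, (Cmod_mult _ l), Htw; lra.
Qed.

(* The derivative of the bracket is (-4)^n s^(2n) (1 + o(1)) at 0. *)
Lemma is_Clim_bracket (n : nat) :
  is_Clim (fun s => bracket n s / s ^ (2 * n + 1)) 0 ((- (4)) ^ n / RtoC (INR (2 * n + 1))).
Proof.
  intros eps Heps.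
  set (N := RtoC (INR (2 * n + 1))).
  assert (HN : N <> 0) by (apply RtoC_neq_0, not_0_INR; lia).
  assert (H4 : (0 < 4 ^ n)%R) by (apply pow_lt; lra).
  (* Division by 4^n cancels the modulus of (-4)^n in [f']; the half leaves room for a strict
     inequality. *)
  set (e := (eps / 2 / 4 ^ n)%R).
  assert (He : (0 < e)%R) by (apply Rdiv_lt_0_compat; lra).
  assert (H0 : (Cmod 0 < 1)%R) by (rewrite Cmod_0; lra).
  assert (Hinv : is_Cderive (fun w => / cosarcsin w) 0
                   (- 0 / cosarcsin 0 * - / (cosarcsin 0 * cosarcsin 0))).
  { apply (is_Cderive_comp Cinv cosarcsin); [|now apply is_Cderive_cosarcsin].
    apply is_Cderive_inv, cosarcsin_neq_0, H0. }
  destruct (is_Cderive_continuous _ _ _ Hinv e He) as [d [Hd Hc]].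
  exists (Rmin 1 d); split; [apply Rmin_glb_lt; lra|].
  intros s Hs0 Hs; pose proof (Rmin_l 1 d); pose proof (Rmin_r 1 d).
  replace (s - 0) with s in Hs by ring.
  assert (Hsn : s ^ (2 * n + 1) <> 0) by now apply Cpow_nz.
  assert (Hsm : (0 < Cmod s ^ (2 * n + 1))%R) by (apply pow_lt, Cmod_gt_0, Hs0).
  (* The bracket minus its leading term. Its derivative [f'] carries the factor 1 / c - 1, which is
     small near 0. *)
  set (f := fun w => bracket n w - (- (4)) ^ n / N * w ^ (2 * n + 1)).
  set (f' := fun w => (- (4)) ^ n * w ^ (2 * n) * (/ cosarcsin w - 1)).
  assert (Hf : (Cmod (f s - f 0) <= (4 ^ n * Cmod s ^ (2 * n) * e) * Cmod (s - 0))%R).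
  { apply (Cmod_increment_le f f'); intros t Ht.
    replace (0 + RtoC t * (s - 0)) with (RtoC t * s) by ring.
    assert (Hts := Cmod_scal_lt t s _ Ht Hs).
    split.
    - eapply is_Cderive_value.
      + apply is_Cderive_minus; [apply is_Cderive_bracket; lra|].
        apply is_Cderive_mult; [apply is_Cderive_const|].
        apply is_Cderive_pow, is_Cderive_id.
      + cbv beta; unfold f'; fold N; replace (2 * n + 1 - 1)%nat with (2 * n)%nat by lia.
        rewrite Cpow_mult_l.
        replace ((RtoC t * s) ^ (2 * n)) with ((RtoC t * s * (RtoC t * s)) ^ n).
        2:{ rewrite Cpow_mult_r; f_equal; simpl; ring. }
        field; split; [apply cosarcsin_neq_0; lra | exact HN].
    - unfold f'; rewrite !Cmod_mult, !Cmod_pow, Cmod_opp, Cmod_R, (Rabs_right 4) by lra.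
      assert (Hcs := Hc (RtoC t * s)).
      rewrite cosarcsin_0 in Hcs; replace (/ RtoC 1) with (RtoC 1) in Hcs by field.
      replace (RtoC t * s - 0) with (RtoC t * s) in Hcs by ring.
      specialize (Hcs ltac:(lra)).
      apply Rmult_le_compat; [apply Rmult_le_pos; [lra | apply pow_le, Cmod_ge_0]
                             | apply Cmod_ge_0 | | lra].
      apply Rmult_le_compat_l; [lra|].
      apply pow_incr; split; [apply Cmod_ge_0|].
      rewrite Cmod_mult, Cmod_R, Rabs_right by lra; pose proof (Cmod_ge_0 s); nra. }
  replace (s - 0) with s in Hf by ring.
  assert (Hf0 : f 0 = 0) by (unfold f; rewrite bracket_0, Cpow_add_r; simpl; ring).
  rewrite Hf0 in Hf; replace (f s - 0) with (f s) in Hf by ring.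
  replace (bracket n s / s ^ (2 * n + 1) - (- (4)) ^ n / N) with (f s / s ^ (2 * n + 1))
    by (unfold f; field; split; assumption).
  rewrite Cmod_div, Cmod_pow by exact Hsn.
  apply Rlt_div_l; [exact Hsm|].
  eapply Rle_lt_trans; [exact Hf|].
  replace (4 ^ n * Cmod s ^ (2 * n) * e * Cmod s)%R with (eps / 2 * Cmod s ^ (2 * n + 1))%R
    by (rewrite pow_add; unfold e; simpl (_ ^ 1)%R; field; lra).
  nra.
Qed.

(* The right-hand side of the theorem as a function of s = sqrt z. *)
Definition rhs_sqrt (n : nat) (s : C) : C :=
  RtoC (INR (fact n) / 4 ^ n)%R
  * (cosarcsin s ^ (2 * n) / cosarcsin s / s ^ (2 * n + 1)) * bracket n s.

(** The number (-1)^n n! / (2n + 1), left as the product of the prefactor and the limit of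
    [bracket n s / s ^ (2 * n + 1)]. *)
Definition rhs_at_0 (n : nat) : C :=
  RtoC (INR (fact n) / 4 ^ n)%R * ((- (4)) ^ n / RtoC (INR (2 * n + 1))).

Lemma is_Clim_rhs_sqrt (n : nat) : is_Clim (rhs_sqrt n) 0 (rhs_at_0 n).
Proof.
  assert (H0 : (Cmod 0 < 1)%R) by (rewrite Cmod_0; lra).
  apply (is_Clim_ext
    (fun s => RtoC (INR (fact n) / 4 ^ n)%R * (cosarcsin s ^ (2 * n) / cosarcsin s)
              * (bracket n s / s ^ (2 * n + 1))) _ _ _ 1 Rlt_0_1).
  { intros w _ _; unfold rhs_sqrt, Cdiv; ring. }
  apply is_Clim_mult; [|apply is_Clim_bracket].
  eapply is_Clim_is_Cderive; [|rewrite cosarcsin_0, Cpow_1_l; field].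
  apply is_Cderive_mult; [apply is_Cderive_const|].
  apply is_Cderive_div; [|now apply is_Cderive_cosarcsin | now apply cosarcsin_neq_0].
  apply is_Cderive_pow; now apply is_Cderive_cosarcsin.
Qed.

Lemma rhs_sqrt_opp (n : nat) (s : C) : (Cmod s < 1)%R -> s <> 0 ->
  rhs_sqrt n (- s) = rhs_sqrt n s.
Proof.
  intros Hs Hs0; unfold rhs_sqrt; rewrite cosarcsin_opp, bracket_opp by exact Hs.
  replace ((- s) ^ (2 * n + 1)) with (- s ^ (2 * n + 1)).
  2:{ rewrite !Cpow_add_r, !Cpow_mult_r.
      replace ((- s) ^ 2) with (s ^ 2) by (simpl; ring); simpl; ring. }
  field; split; [now apply cosarcsin_neq_0 | now apply Cpow_nz].
Qed.

Lemma is_Clim_rhs_sqrt_Csqrt (n : nat) : is_Clim (fun z => rhs_sqrt n (Csqrt z)) 0 (rhs_at_0 n).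
Proof.
  intros eps Heps; destruct (is_Clim_rhs_sqrt n eps Heps) as [d [Hd H]].
  (* As |sqrt w| = sqrt |w|, the radius d for s corresponds to d^2 for z; continuity of the root is
     not involved. *)
  exists (d * d)%R; split; [nra|].
  intros w Hw0 Hw; apply H; [now apply Csqrt_neq_0|].
  replace (w - 0) with w in Hw by ring.
  replace (Csqrt w - 0) with (Csqrt w) by ring.
  rewrite Cmod_Csqrt, <- (sqrt_square d) by lra.
  apply sqrt_lt_1; [apply Cmod_ge_0 | nra | exact Hw].
Qed.

(** * Both sides of the formula as functions of the square root *)

(** The exponent 2n - 1 is expressed by a division, since natural subtraction would truncate it at n
    = 0. *)
Lemma Cpower_half_integer (w : C) (n : nat) : w <> 0 ->
  Cpower w (RtoC (INR n - 1 / 2)%R) = Csqrt w ^ (2 * n) / Csqrt w.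
Proof.
  intros Hw; unfold Cpower.
  replace (RtoC (INR n - 1 / 2)%R * Clog w) with (RtoC (INR n) * Clog w + - (1 / 2 * Clog w)).
  2:{ rewrite RtoC_minus, RtoC_div by lra; ring. }
  rewrite Cexp_plus, Cexp_INR_mult, Cexp_Clog, Cexp_opp, <- Csqrt_Cexp by exact Hw.
  unfold Cdiv; f_equal.
  rewrite Cpow_mult_r; f_equal; simpl; rewrite Cmult_1_r, Csqrt_sqr; reflexivity.
Qed.

Lemma arcsin_rhs_sqrt (n : nat) (z : C) : (Cmod z < 1)%R ->
  arcsin_rhs n z = rhs_sqrt n (Csqrt z).
Proof.
  intros Hz.
  assert (Hc : cosarcsin (Csqrt z) = Csqrt (1 - z)) by (unfold cosarcsin; now rewrite Csqrt_sqr).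
  unfold arcsin_rhs, rhs_sqrt; rewrite Cpower_half_integer, Hc.
  - reflexivity.
  - now apply C_neq_0_of_Re_pos, Re_one_minus_pos.
Qed.

Lemma bracket_order_0 (s : C) : bracket 0 s = Carcsin s.
Proof.
  unfold bracket; simpl (2 * 0)%nat; rewrite Csum_0, binomial_0; simpl.
  rewrite Rmult_1_r; ring.
Qed.

Lemma arcsin_fun_rhs_sqrt (z : C) : (Cmod z < 1)%R -> z <> 0 ->
  arcsin_fun z = rhs_sqrt 0 (Csqrt z).
Proof.
  intros Hz Hz0.
  assert (Hc : cosarcsin (Csqrt z) = Csqrt (1 - z)) by (unfold cosarcsin; now rewrite Csqrt_sqr).
  unfold arcsin_fun, rhs_sqrt; rewrite Csqrt_mult_one_minus, bracket_order_0, Hc by exact Hz.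
  replace (RtoC (INR (fact 0) / 4 ^ 0)%R) with (RtoC 1) by (f_equal; simpl; field).
  simpl; field; split.
  - rewrite <- Hc; now apply cosarcsin_neq_0, Cmod_Csqrt_lt_1.
  - now apply Csqrt_neq_0.
Qed.

Lemma is_Clim_arcsin_rhs (n : nat) : is_Clim (arcsin_rhs n) 0 (rhs_at_0 n).
Proof.
  apply (is_Clim_ext (fun z => rhs_sqrt n (Csqrt z)) _ _ _ 1 Rlt_0_1).
  - intros w _ Hw; symmetry; apply arcsin_rhs_sqrt.
    now replace (w - 0) with w in Hw by ring.
  - apply is_Clim_rhs_sqrt_Csqrt.
Qed.

Lemma is_Clim_arcsin_fun : is_Clim arcsin_fun 0 (rhs_at_0 0).
Proof.
  apply (is_Clim_ext (fun z => rhs_sqrt 0 (Csqrt z)) _ _ _ 1 Rlt_0_1).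
  - intros w Hw0 Hw; symmetry; apply arcsin_fun_rhs_sqrt; [|exact Hw0].
    now replace (w - 0) with w in Hw by ring.
  - apply is_Clim_rhs_sqrt_Csqrt.
Qed.

(** The continuous extension with its value at 0 made explicit; the induction over the iterates runs
    on this form. *)
Definition rhs_ext (n : nat) (z : C) : C :=
  if Ceq_dec z 0 then rhs_at_0 n else rhs_sqrt n (Csqrt z).

Lemma rhs_ext_neq_0 (n : nat) (z : C) : z <> 0 -> rhs_ext n z = rhs_sqrt n (Csqrt z).
Proof. intros Hz; unfold rhs_ext; now destruct (Ceq_dec z 0). Qed.

Lemma rhs_ext_0 (n : nat) : rhs_ext n 0 = rhs_at_0 n.
Proof. unfold rhs_ext; now destruct (Ceq_dec 0 0). Qed.

Lemma Cext0_arcsin_rhs (n : nat) (z : C) : (Cmod z < 1)%R ->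
  Cext0 (arcsin_rhs n) z = rhs_ext n z.
Proof.
  intros Hz; unfold Cext0, rhs_ext; destruct (Ceq_dec z 0) as [_|_].
  - apply is_C_lim_unique, is_Clim_filterlim, is_Clim_arcsin_rhs.
  - now apply arcsin_rhs_sqrt.
Qed.

Lemma Cext0_arcsin_fun (z : C) : (Cmod z < 1)%R -> Cext0 arcsin_fun z = rhs_ext 0 z.
Proof.
  intros Hz; unfold Cext0, rhs_ext; destruct (Ceq_dec z 0) as [_|Hz0].
  - apply is_C_lim_unique, is_Clim_filterlim, is_Clim_arcsin_fun.
  - now apply arcsin_fun_rhs_sqrt.
Qed.

(** * One application of the operator, and the induction *)

(** Since 1 - w^2 = c^2, the function is a constant times (c / w)^{2n+1} times the bracket, and (c /
    w)' = -1 / (c w^2). The product rule yields exactly the combination of [bracket n s] and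
    s^{2n+1} c that [bracket_S] turns into [bracket (S n) s]. *)
Lemma is_Cderive_rhs_sqrt (n : nat) (s : C) : (Cmod s < 1)%R -> s <> 0 ->
  is_Cderive (fun w => (1 - w * w) * rhs_sqrt n w) s
    (2 * s * rhs_sqrt (S n) s / (1 - s * s)).
Proof.
  intros Hs Hs0; pose proof (cosarcsin_neq_0 s Hs) as Hc.
  set (k := RtoC (INR (fact n) / 4 ^ n)%R).
  assert (Hball : forall w, (Cmod (w - s) < Rmin (1 - Cmod s) (Cmod s))%R ->
                   (Cmod w < 1)%R /\ w <> 0).
  { intros w Hw; pose proof (Rmin_l (1 - Cmod s) (Cmod s)).
    pose proof (Rmin_r (1 - Cmod s) (Cmod s)); split.
    - pose proof (Cmod_triangle (w - s) s).
      replace (w - s + s) with w in * by ring; lra.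
    - intros ->; replace (0 - s) with (- s) in Hw by ring; rewrite Cmod_opp in Hw; lra. }
  apply (is_Cderive_ext_loc (fun w => k * ((cosarcsin w / w) ^ (2 * n + 1) * bracket n w))
           _ _ _ (Rmin (1 - Cmod s) (Cmod s))).
  { apply Rmin_glb_lt; [lra | now apply Cmod_gt_0]. }
  { intros w Hw; destruct (Hball w Hw) as [Hw1 Hw0].
    unfold rhs_sqrt; fold k; rewrite <- cosarcsin_sqr.
    unfold Cdiv; rewrite Cpow_mult_l, Cpow_inv, !Cpow_add_r, !Cpow_1_r by exact Hw0.
    field; repeat split; (exact Hw0 || now apply cosarcsin_neq_0 || now apply Cpow_nz). }
  eapply is_Cderive_value.
  - apply is_Cderive_mult; [apply is_Cderive_const|].
    apply is_Cderive_mult; [|now apply is_Cderive_bracket].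
    apply is_Cderive_pow.
    apply is_Cderive_div; [now apply is_Cderive_cosarcsin | apply is_Cderive_id | exact Hs0].
  - cbv beta; replace (2 * n + 1 - 1)%nat with (2 * n)%nat by lia.
    assert (HN : RtoC (INR (2 * n + 2)) <> 0) by (apply RtoC_neq_0, not_0_INR; lia).
    assert (Hb : bracket (S n) s =
      - (4) * (RtoC (INR (2 * n + 1)) * bracket n s
               - (- (4)) ^ n * (s ^ (2 * n + 1) * cosarcsin s)) / RtoC (INR (2 * n + 2))).
    { rewrite <- bracket_S by exact Hs; field; exact HN. }
    assert (Hk : RtoC (INR (fact (S n)) / 4 ^ S n)%R = k * RtoC (INR (2 * n + 2)) / 8).
    { unfold k; rewrite <- RtoC_mult, <- RtoC_div by lra; f_equal.
      replace (2 * n + 2)%nat with (2 * S n)%nat by lia.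
      rewrite fact_simpl, !mult_INR; simpl (4 ^ S n)%R; simpl (INR 2).
      field; apply pow_nonzero; lra. }
    unfold rhs_sqrt; rewrite Hb, Hk, <- cosarcsin_sqr.
    set (c := cosarcsin s) in *.
    assert (E : - s / c * s - c * 1 = - (1) / c).
    { replace (- s / c * s - c * 1) with (- (s * s + c * c) / c) by (field; exact Hc).
      unfold c; rewrite cosarcsin_sqr; f_equal; ring. }
    rewrite E.
    assert (Hodd : forall u : C, u ^ (2 * n + 1) = u ^ n * u ^ n * u).
    { intros u; rewrite Cpow_add_r, Cpow_1_r, <- Cpow_add_r; do 2 f_equal; lia. }
    assert (Heven : forall u : C, u ^ (2 * n) = u ^ n * u ^ n).
    { intros u; rewrite <- Cpow_add_r; f_equal; lia. }
    replace (2 * S n + 1)%nat with (S (S (2 * n + 1))) by lia.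
    replace (2 * S n)%nat with (S (S (2 * n))) by lia.
    rewrite !Cpow_S, !Hodd, !Heven, !Cpow_mult_l; unfold Cdiv; rewrite !Cpow_mult_l.
    rewrite !Cpow_inv by exact Hs0.
    pose proof (Cpow_nz s n Hs0) as Hsn.
    field; repeat split; assumption.
Qed.

(* Away from 0 the branch s0 sqrt (z / z0) of the square root, s0 = sqrt z0, is
   holomorphic at z0; evenness of rhs_sqrt makes the choice of branch irrelevant. *)
Lemma is_Cderive_rhs_Csqrt (n : nat) (z0 : C) : (Cmod z0 < 1)%R -> z0 <> 0 ->
  is_Cderive (fun z => (1 - z) * rhs_sqrt n (Csqrt z)) z0
    (rhs_sqrt (S n) (Csqrt z0) / (1 - z0)).
Proof.
  intros Hz Hz0.
  set (s0 := Csqrt z0).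
  assert (Hs0 : s0 <> 0) by now apply Csqrt_neq_0.
  assert (Hs0z : s0 * s0 = z0) by apply Csqrt_sqr.
  assert (Hs1 : (Cmod s0 < 1)%R) by now apply Cmod_Csqrt_lt_1.
  assert (H1z : 1 - z0 <> 0) by now apply C_neq_0_of_Re_pos, Re_one_minus_pos.
  set (branch := fun z => s0 * Csqrt (z / z0)).
  assert (Hb : branch z0 = s0).
  { unfold branch; replace (z0 / z0) with (RtoC 1) by (field; exact Hz0).
    rewrite Csqrt_1; ring. }
  assert (Hbsqr : forall z, branch z * branch z = z).
  { intros z; unfold branch.
    replace (s0 * Csqrt (z / z0) * (s0 * Csqrt (z / z0)))
      with (s0 * s0 * (Csqrt (z / z0) * Csqrt (z / z0))) by ring.
    rewrite Csqrt_sqr, Hs0z; field; exact Hz0. }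
  assert (Hdb : is_Cderive branch z0 (/ (2 * s0))).
  { unfold branch; eapply is_Cderive_value.
    - apply is_Cderive_mult; [apply is_Cderive_const|].
      apply (is_Cderive_comp Csqrt (fun z => z / z0)).
      + apply is_Cderive_Csqrt.
        replace (z0 / z0) with (RtoC 1) by (field; exact Hz0); simpl; lra.
      + apply is_Cderive_div; [apply is_Cderive_id | apply is_Cderive_const | exact Hz0].
    - cbv beta; replace (z0 / z0) with (RtoC 1) by (field; exact Hz0).
      rewrite Csqrt_1, <- Hs0z; field; exact Hs0. }
  apply (is_Cderive_ext_loc
    (fun z => (1 - branch z * branch z) * rhs_sqrt n (branch z)) _ _ _
    (Rmin (1 - Cmod z0) (Cmod z0))).
  { apply Rmin_glb_lt; [lra | now apply Cmod_gt_0]. }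
  { intros w Hw.
    pose proof (Rmin_l (1 - Cmod z0) (Cmod z0)); pose proof (Rmin_r (1 - Cmod z0) (Cmod z0)).
    assert (Hw1 : (Cmod w < 1)%R).
    { pose proof (Cmod_triangle (w - z0) z0).
      replace (w - z0 + z0) with w in * by ring; lra. }
    assert (Hw0 : w <> 0).
    { intros ->; replace (0 - z0) with (- z0) in Hw by ring; rewrite Cmod_opp in Hw; lra. }
    rewrite Hbsqr; f_equal.
    (* Both numbers square to w, so they agree up to sign. *)
    destruct (Csqr_eq (branch w) (Csqrt w)) as [->| ->]; [|reflexivity|].
    - now rewrite Hbsqr, Csqrt_sqr.
    - apply rhs_sqrt_opp; [now apply Cmod_Csqrt_lt_1 | now apply Csqrt_neq_0]. }
  eapply is_Cderive_value.
  - apply (is_Cderive_comp (fun s => (1 - s * s) * rhs_sqrt n s) branch); [|exact Hdb].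
    rewrite Hb; now apply is_Cderive_rhs_sqrt.
  - rewrite Hs0z; field; split; assumption.
Qed.

(** At 0 the derivative at nearby points is [rhs_ext (S n) w / (1 - w)], whose limit is already
    known from the limit of the right-hand side for n + 1. *)
Lemma is_Cderive_rhs_ext (n : nat) (z : C) : (Cmod z < 1)%R ->
  is_Cderive (fun w => (1 - w) * rhs_ext n w) z (rhs_ext (S n) z / (1 - z)).
Proof.
  intros Hz; destruct (Ceq_dec z 0) as [->|Hz0].
  - assert (H1 : is_Clim (fun w => 1 - w) 0 1).
    { eapply is_Clim_is_Cderive.
      - apply is_Cderive_minus; [apply is_Cderive_const | apply is_Cderive_id].
      - cbv beta; ring. }
    assert (H1' : is_Clim (fun w => / (1 - w)) 0 1).
    { eapply is_Clim_is_Cderive.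
      - apply (is_Cderive_comp Cinv (fun w => 1 - w)).
        + apply is_Cderive_inv; replace (1 - 0) with (RtoC 1) by ring; apply C1_nz.
        + apply is_Cderive_minus; [apply is_Cderive_const | apply is_Cderive_id].
      - cbv beta; field. }
    assert (Hlim : forall m, is_Clim (rhs_ext m) 0 (rhs_at_0 m)).
    { intros m; apply (is_Clim_ext (fun w => rhs_sqrt m (Csqrt w)) _ _ _ 1 Rlt_0_1).
      - intros w Hw _; symmetry; now apply rhs_ext_neq_0.
      - apply is_Clim_rhs_sqrt_Csqrt. }
    apply (is_Cderive_of_derivative_limit _ (fun w => rhs_ext (S n) w / (1 - w)) _ 1 Rlt_0_1).
    + intros w Hw0 Hw; rewrite rhs_ext_neq_0 by exact Hw0.
      apply (is_Cderive_ext_loc (fun w => (1 - w) * rhs_sqrt n (Csqrt w)) _ _ _ (Cmod w)).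
      * now apply Cmod_gt_0.
      * intros u Hu; rewrite rhs_ext_neq_0; [reflexivity|].
        intros ->; replace (0 - w) with (- w) in Hu by ring; rewrite Cmod_opp in Hu; lra.
      * now apply is_Cderive_rhs_Csqrt.
    + rewrite rhs_ext_0; replace (1 - 0) with (RtoC 1) by ring.
      now apply is_Clim_mult.
    + rewrite rhs_ext_0; replace (rhs_at_0 (S n) / (1 - 0)) with (rhs_at_0 (S n) * 1) by field.
      now apply is_Clim_mult.
  - rewrite rhs_ext_neq_0 by exact Hz0.
    apply (is_Cderive_ext_loc (fun w => (1 - w) * rhs_sqrt n (Csqrt w)) _ _ _ (Cmod z)).
    + now apply Cmod_gt_0.
    + intros u Hu; rewrite rhs_ext_neq_0; [reflexivity|].
      intros ->; replace (0 - z) with (- z) in Hu by ring; rewrite Cmod_opp in Hu; lra.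
    + now apply is_Cderive_rhs_Csqrt.
Qed.

(** The iterates are known only on the open disc; differentiation being local, agreement there is
    enough. The lemma serves both the induction step and the differentiability of every iterate. *)
Lemma is_Cderive_one_minus_mult_of_eq_rhs_ext (n : nat) (f : C -> C) (z : C) :
  (forall w, (Cmod w < 1)%R -> f w = rhs_ext n w) -> (Cmod z < 1)%R ->
  is_Cderive (fun w => (1 - w) * f w) z (rhs_ext (S n) z / (1 - z)).
Proof.
  intros Hf Hz.
  apply (is_Cderive_ext_loc (fun w => (1 - w) * rhs_ext n w) _ _ _ (1 - Cmod z)).
  - lra.
  - intros w Hw; rewrite Hf; [reflexivity|].
    pose proof (Cmod_triangle (w - z) z).
    replace (w - z + z) with w in * by ring; lra.
  - now apply is_Cderive_rhs_ext.
Qed.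

Lemma iter_opD_rhs_ext (n : nat) (z : C) : (Cmod z < 1)%R ->
  Nat.iter n opD (Cext0 arcsin_fun) z = rhs_ext n z.
Proof.
  revert z; induction n as [|n IH]; intros z Hz; [now apply Cext0_arcsin_fun|].
  simpl; unfold opD at 1.
  rewrite (is_C_derive_unique _ _ _ (is_Cderive_one_minus_mult_of_eq_rhs_ext n _ z IH Hz)).
  field; now apply C_neq_0_of_Re_pos, Re_one_minus_pos.
Qed.

Theorem corollary5 (n : nat) :
  (has_Clim arcsin_fun 0%C
   /\ has_Clim (arcsin_rhs n) 0%C
   /\ opD_defined n (Cext0 arcsin_fun))
  /\ forall z : C, (Cmod z < 1)%R ->
       Nat.iter n opD (Cext0 arcsin_fun) z = Cext0 (arcsin_rhs n) z.
Proof.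
  repeat split.
  - exists (rhs_at_0 0); apply is_Clim_filterlim, is_Clim_arcsin_fun.
  - exists (rhs_at_0 n); apply is_Clim_filterlim, is_Clim_arcsin_rhs.
  - intros m z _ Hz; eexists.
    exact (is_Cderive_one_minus_mult_of_eq_rhs_ext m _ z (iter_opD_rhs_ext m) Hz).
  - intros z Hz; rewrite Cext0_arcsin_rhs by exact Hz; now apply iter_opD_rhs_ext.
Qed.
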